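(* Let $u,v\in\mathbb{R}^2$ be linearly independent unit vectors with angle $2\beta\in(0,\pi)$ between them, and let $\alpha=(\alpha_x,\alpha_y)=\frac{u+v}{\|u+v\|}$. Let $T$ denote the V-line transform with branches in the directions $u,v$. (i) If $f\in C_c(\mathbb{R}^2)$, then for every $(x,y)\in\mathbb{R}^2$ $$f(x,y)=\frac{1}{2\cos\beta}\,\frac{\partial}{\partial u}\frac{\partial}{\partial v}\int_0^\infty (Tf)(x+t\alpha_x,\,y+t\alpha_y)\,dt .$$ (ii) If $f\in L^1(\mathbb{R}^2)$, then for almost every $(x,y)\in\mathbb{R}^2$ $$f(x,y)=\lim_{t\to0}A_t(x,y),$$ where, with $F(x,y)=\sin\beta\int_0^\infty (Tf)(x+t\alpha_x,y+t\alpha_y)\,dt$ and $p=(x,y)$, $$A_t(x,y)=\frac{1}{t^2|\det(u,v)|}\Big[F\big(p+\tfrac t2u+\tfrac t2v\big)-F\big(p-\tfrac t2u+\tfrac t2v\big)-F\big(p+\tfrac t2u-\tfrac t2v\big)+F\big(p-\tfrac t2u-\tfrac t2v\big)\Big].$$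
   Context: For $(x,y)\in\mathbb{R}^2$ and a unit vector $w$, $R_w(x,y)=\{(x,y)+tw:t\ge0\}$. The V-line with vertex $(x,y)$ is $L(x,y)=R_u(x,y)\cup R_v(x,y)$, and the (ordinary) V-line transform of $f$ is $(Tf)(x,y)=\int_{L(x,y)}f\,dl=\int_{R_u(x,y)}f\,dl+\int_{R_v(x,y)}f\,dl$, where $dl$ is the one-dimensional Lebesgue measure; for $f\in L^1(\mathbb{R}^2)$ it is defined for almost every $(x,y)$. $\frac{\partial}{\partial u},\frac{\partial}{\partial v}$ are directional derivatives. *)

(* Defs.v *)
From HB Require Import structures.
From mathcomp Require Import all_boot all_order all_algebra.
From mathcomp Require Import all_classical all_reals all_analysis.

Set Implicit Arguments.
Unset Strict Implicit.
Unset Printing Implicit Defensive.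

Import Order.TTheory GRing.Theory Num.Theory.
Import numFieldNormedType.Exports.

Local Open Scope classical_set_scope.
Local Open Scope ring_scope.

(* Points and vectors of the plane are elements of R * R.  The norm that the
   library puts on R * R is the sup norm: it is used here only through the
   topology it induces (continuity, compactness, directional derivatives).
   Lengths and angles are Euclidean and refer to [dot] and [enorm]. *)

Notation leb1 R := (@lebesgue_measure R).
Notation leb2 R := (@lebesgue_measure R \x @lebesgue_measure R)%E.

Section VLine.
Variable R : realType.
Implicit Types (u v p : R * R) (f : R * R -> R).

Definition dot u v : R := u.1 * v.1 + u.2 * v.2.

Definition enorm u : R := Num.sqrt (dot u u).

Definition angle u v : R := acos (dot u v / (enorm u * enorm v)).

Definition det2 u v : R := u.1 * v.2 - u.2 * v.1.

Definition bisector u v : R * R := (enorm (u + v))^-1 *: (u + v).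

Definition continuous_compact_support f : Prop :=
  continuous f /\ compact (closure [set p | f p != 0]).

(* For a unit vector w, t |-> p + t w parametrizes the ray R_w(p) by arc
   length, so the integral below is the integral of f over R_w(p) with respect
   to one-dimensional Lebesgue measure. *)
Definition ray_integral f w p : R :=
  \int[leb1 R]_(t in `[0, +oo[) f (p + t *: w).

Definition ray_integrable f w p : Prop :=
  (leb1 R).-integrable `[0, +oo[ (fun t => (f (p + t *: w))%:E).

Definition vline f u v p : R := ray_integral f u p + ray_integral f v p.

(* The library's integral is total; this says that [vline f u v p] is
   a genuine (absolutely convergent) integral. *)
Definition vline_defined f u v p : Prop :=
  ray_integrable f u p /\ ray_integrable f v p.

Definition vline_axis f u v p : R := ray_integral (vline f u v) (bisector u v) p.

Definition vline_axis_defined f u v p : Prop :=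
  (\forall t \ae leb1 R, 0 <= t -> vline_defined f u v (p + t *: bisector u v))
  /\ ray_integrable (vline f u v) (bisector u v) p.

Definition second_difference (F : R * R -> R) u v p (t : R) : R :=
  (t ^+ 2 * `|det2 u v|)^-1 *
  (F (p + (t / 2) *: u + (t / 2) *: v) - F (p - (t / 2) *: u + (t / 2) *: v)
   - F (p + (t / 2) *: u - (t / 2) *: v) + F (p - (t / 2) *: u - (t / 2) *: v)).

End VLine.

(* Main.v *)
Require Import Defs.
From HB Require Import structures.
From mathcomp Require Import all_boot all_order all_algebra.
From mathcomp Require Import all_classical all_reals all_analysis.
From mathcomp Require Import measurable_realfun lra ring.

Set Implicit Arguments.
Unset Strict Implicit.
Unset Printing Implicit Defensive.

Import Order.TTheory GRing.Theory Num.Theory.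
Import numFieldNormedType.Exports.

Local Open Scope classical_set_scope.
Local Open Scope ring_scope.

(** Let [D = det2 u v].  In the coordinates [(a, b)] of the frame
    [p + a u + b v], a V-line with vertex on the axis of [p] is a pair of
    half-lines parallel to the coordinate axes that start on the diagonal.  When
    the vertex runs along the axis, the [u] branches sweep the cone
    [0 <= b <= a] and the [v] branches the cone [0 <= a <= b], both with
    Jacobian [1 / |u + v|].  Hence [vline_axis_quadrant]:

      vline_axis f u v p = |u + v| * (integral of f(p + a u + b v), a, b >= 0),

    where [|u + v| = 2 cos beta] and [|D| = sin beta * |u + v|], and the theorem
    says how to recover [f] from its integrals over sectors.

    If [f] is continuous with compact support, the sector integral is an
    iterated ray integral.  A ray integral, seen as a function of its vertex,
    has derivative [- f] along the ray by the fundamental theorem of calculus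
    [is_derive_ray_integral].  This is used along [v], for the function
    [ray_integral f u], which is continuous on lines of direction [v] by
    dominated convergence [ray_integral_continuous], and then along [u].

    If [f] is integrable, the second difference of the sector integral is by
    inclusion-exclusion an integral over the parallelogram of centre [p] and
    sides [t u] and [t v], that is, over a square of side [|t|] in the
    coordinates [(a, b)].  Thus [second_difference_average] identifies the
    quotient with an average of [f] in these coordinates, and the limit is
    Lebesgue's differentiation theorem in the plane for squares
    [plane_lebesgue_differentiation]; linear maps preserve null sets
    [ae_plane_affine].

    The differentiation theorem is proved in the usual way.  A Vitali covering
    argument for finitely many squares gives a maximal inequality, by which the
    functions whose averages converge almost everywhere form a closed subset
    of L1 [differentiable_ae_L1_closed].  It contains the indicators of
    rectangles, by the one-dimensional density theorem, hence those of bounded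
    measurable sets by a Dynkin argument, hence the simple functions.

    The axial integral exists by Fubini's theorem, since a linear change of
    variables turns the iterated ray integrals of an integrable function into
    section integrals of an integrable function.  For continuous [f] every
    single ray integral exists, because a line meets the support in a bounded
    set of parameters. *)

(** * Maps that scale a measure, and affine changes of variables *)

Section measure_scaling_map.
Local Open Scope ereal_scope.
Context d (T : measurableType d) (R : realType).
Variables (mu : {measure set T -> \bar R}) (phi : T -> T) (k : R).
Hypothesis k_ge0 : (0 <= k)%R.
Hypothesis mphi : measurable_fun [set: T] phi.
Hypothesis phiE : forall A, measurable A -> mu (phi @^-1` A) = k%:E * mu A.

Lemma ge0_integral_scaling_map (h : T -> \bar R) :
  measurable_fun [set: T] h -> (forall x, 0 <= h x) ->
  \int[mu]_x h (phi x) = k%:E * \int[mu]_x h x.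
Proof.
move=> mh h0; rewrite -(ge0_integral_mscale mu measurableT (NngNum k_ge0))//.
have := @ge0_integral_pushforward _ _ _ _ _ phi mphi mu setT h measurableT mh
  (fun x _ => h0 x).
rewrite preimage_setT => mE; apply: (eq_trans (esym mE)).
by apply: eq_measure_integral => A mA _; exact: phiE.
Qed.

Lemma integrable_scaling_map (h : T -> \bar R) :
  mu.-integrable [set: T] h -> mu.-integrable [set: T] (h \o phi).
Proof.
move=> /integrableP[mh hoo]; apply/integrableP; split.
  exact: measurableT_comp.
rewrite (ge0_integral_scaling_map (h := abse \o h))//.
- by rewrite lte_mul_pinfty// lee_fin.
- exact: measurableT_comp.
- by move=> x; exact: abse_ge0.
Qed.

Lemma integral_scaling_map (h : T -> \bar R) :
  mu.-integrable [set: T] h ->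
  \int[mu]_x h (phi x) = k%:E * \int[mu]_x h x.
Proof.
move=> ih; have mh := measurable_int _ ih.
rewrite [LHS]integralE [in RHS]integralE.
under eq_integral do rewrite (funepos_comp h phi)/=.
under [X in _ - X]eq_integral do rewrite (funeneg_comp h phi)/=.
rewrite !ge0_integral_scaling_map//.
- by rewrite [RHS]muleBr//; exact: integrable_add_def.
- exact: measurable_funeneg.
- exact: measurable_funepos.
Qed.

Lemma ae_scaling_map (P : set T) :
  {ae mu, forall x, P x} -> {ae mu, forall x, P (phi x)}.
Proof.
move=> [N [mN N0 PN]]; exists (phi @^-1` N); split.
- by rewrite -[_ @^-1` _]setTI; exact: mphi.
- by rewrite phiE// N0 mule0.
- by move=> x /= nPx; exact: PN.
Qed.

End measure_scaling_map.

Section affine_change_of_variables.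
Context {R : realType}.
Local Notation leb := (leb1 R).
Local Notation leb2 := (leb2 R).
Implicit Types (A : set R) (E : set (R * R)).

Lemma measurable_affine (c d : R) :
  measurable_fun [set: R] (fun x => c * x + d).
Proof. by apply: measurable_funD => //; exact: measurable_funM. Qed.

(** By uniqueness of Lebesgue measure it is enough to compare the two measures
    on the intervals ]a, b], whose preimages are again intervals; a negative
    slope exchanges the closed and the open endpoint. *)
Lemma lebesgue_measure_affine (c d : R) A : c != 0 -> measurable A ->
  leb ((fun x => c * x + d) @^-1` A) = ((`|c|^-1)%:E * leb A)%E.
Proof.
move=> c0 mA.
pose phi : measurableTypeR R -> measurableTypeR R := fun x : R => c * x + d.
have mphi : measurable_fun [set: R] phi by exact: measurable_affine.
have [m mE] : exists m : {measure set (measurableTypeR R) -> \bar R},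
    forall B, m B = (`|c|%:E * leb (phi @^-1` B))%E.
  by unshelve eexists (mscale (NngNum (normr_ge0 c))
    (@pushforward _ _ (measurableTypeR R) (measurableTypeR R) R leb phi)).
have -> : leb A = m A.
  apply: (@lebesgue_measure_unique R m) => // _ [[a b] /= _ <-].
  rewrite mE.
  have [c_gt0|c_le0] := ltP 0 c.
    have -> : phi @^-1` [set` `]a, b]] = `](a - d) / c, (b - d) / c]%classic.
      by apply/seteqP; split => x /=; rewrite !in_itv/=
        ltr_pdivrMr// ler_pdivlMr// ltrBlDr lerBrDr mulrC.
    rewrite !lebesgue_measure_itv/= !lte_fin ltr_pM2r ?invr_gt0// ltrD2r.
    case: ifPn => _; last by rewrite mule0.
    by rewrite -!EFinD -EFinM gtr0_norm//; congr EFin; field.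
  have c_lt0 : c < 0 by rewrite lt_neqAle c0.
  have -> : phi @^-1` [set` `]a, b]] = `[(b - d) / c, (a - d) / c[%classic.
    by apply/seteqP; split => x /=; rewrite !in_itv/=
      ltr_ndivlMr// ler_ndivrMr// ltrBlDr lerBrDr mulrC andbC.
  rewrite !lebesgue_measure_itv/= !lte_fin ltr_nM2r ?invr_lt0// ltrD2r.
  case: ifPn => _; last by rewrite mule0.
  by rewrite -!EFinD -EFinM ltr0_norm//; congr EFin; field.
by rewrite mE muleA -EFinM mulVf ?normr_eq0// mul1e.
Qed.

Lemma ge0_integral_affine (c d : R) (h : R -> \bar R) : c != 0 ->
  measurable_fun [set: R] h -> (forall x, 0 <= h x)%E ->
  (\int[leb]_x h (c * x + d)%R = (`|c|^-1)%:E * \int[leb]_x h x)%E.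
Proof.
move=> c0 mh h0.
apply: (ge0_integral_scaling_map (mu := leb) (phi := fun x => c * x + d)
  (k := `|c|^-1)) => //.
- exact: measurable_affine.
- by move=> A; exact: lebesgue_measure_affine.
Qed.

Lemma leb2_ysection E : measurable E ->
  leb2 E = (\int[leb]_y leb (ysection E y))%E.
Proof.
move=> mE; rewrite (@product_measure_unique _ _ _ _ _ leb leb (leb \x^ leb)%E)//.
by move=> A B mA mB; rewrite /= product_measure2E.
Qed.

(** Every vertical section of the preimage is an affine preimage of a vertical
    section, so the claim is the one-dimensional one, used first in the second
    variable and then in the first. *)
Lemma leb2_lower_triangular (c d k m e : R) E :
  c != 0 -> d != 0 -> measurable E ->
  leb2 ((fun q => (c * q.1 + m, k * q.1 + d * q.2 + e)) @^-1` E) =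
  ((`|c * d|^-1)%:E * leb2 E)%E.
Proof.
move=> c0 d0 mE; rewrite /product_measure1.
have mh : measurable_fun [set: R] (leb \o xsection E).
  exact: measurable_fun_xsection.
transitivity (\int[leb]_x ((`|d|^-1)%:E * leb (xsection E (c * x + m))%R))%E.
  apply: eq_integral => x _ /=.
  rewrite -(lebesgue_measure_affine (k * x + e) d0); last first.
    exact: measurable_xsection.
  congr (leb _); apply/funext => y; rewrite /xsection/= !inE/=.
  by congr (E (_, _)); ring.
rewrite ge0_integralZl//.
- rewrite (@ge0_integral_affine c m (leb \o xsection E))//.
  by rewrite muleA -EFinM normrM invfM mulrC.
- by apply: (measurableT_comp mh); exact: measurable_affine.
Qed.

(** The same argument with horizontal sections. *)
Lemma leb2_upper_triangular (c d k m e : R) E :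
  c != 0 -> d != 0 -> measurable E ->
  leb2 ((fun q => (c * q.1 + k * q.2 + m, d * q.2 + e)) @^-1` E) =
  ((`|c * d|^-1)%:E * leb2 E)%E.
Proof.
move=> c0 d0 mE; rewrite !leb2_ysection//; last first.
  rewrite -[_ @^-1` _]setTI; apply: measurable_fun_pair => //.
    by apply: measurable_funD => //; apply: measurable_funD => //;
      exact: measurable_funM.
  by apply: measurable_funD => //; exact: measurable_funM.
have mh : measurable_fun [set: R] (leb \o ysection E).
  exact: measurable_fun_ysection.
transitivity (\int[leb]_y ((`|c|^-1)%:E * leb (ysection E (d * y + e))%R))%E.
  apply: eq_integral => x _ /=.
  rewrite -(lebesgue_measure_affine (k * x + m) c0); last first.
    exact: measurable_ysection.
  congr (leb _); apply/funext => y; rewrite /ysection/= !inE/=.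
  by congr (E (_, _)); ring.
rewrite ge0_integralZl//.
- rewrite (@ge0_integral_affine d e (leb \o ysection E))//.
  by rewrite muleA -EFinM normrM invfM.
- by apply: (measurableT_comp mh); exact: measurable_affine.
Qed.

(** The point of coordinates [q] in the affine frame [(p; w, w')]. *)
Definition plane_affine (p w w' q : R * R) : R * R :=
  p + q.1 *: w + q.2 *: w'.

Lemma plane_affineE p w w' q : plane_affine p w w' q =
  (w.1 * q.1 + w'.1 * q.2 + p.1, w.2 * q.1 + w'.2 * q.2 + p.2).
Proof.
case: p w w' q => [p1 p2] [a b] [c d] [x y]; rewrite /plane_affine.
by congr (_, _); rewrite /= /GRing.scale/=; ring.
Qed.

Lemma measurable_plane_affine p w w' :
  measurable_fun [set: R * R] (plane_affine p w w').
Proof.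
rewrite (funext (plane_affineE p w w')).
by apply: measurable_fun_pair;
  apply: measurable_funD => //; apply: measurable_funD => //;
  exact: measurable_funM.
Qed.

(** When [w.1 != 0] the matrix with columns [w, w'] factors as a lower
    triangular one times an upper triangular one.  When [w.1 = 0] then
    [w'.1 != 0], and the shear that replaces [w] by [w + w'] keeps the
    determinant and reduces to the first case. *)
Lemma leb2_plane_affine p w w' E : det2 w w' != 0 -> measurable E ->
  leb2 (plane_affine p w w' @^-1` E) = ((`|det2 w w'|^-1)%:E * leb2 E)%E.
Proof.
wlog w10 : w / w.1 != 0 => [wlg D0 mE|D0 mE].
  have [w10|w10] := eqVneq w.1 0; last exact: wlg.
  have w'10 : w'.1 != 0.
    by apply: contraNneq D0 => w'10; rewrite /det2 w10 w'10 mul0r mulr0 subrr.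
  have detE : det2 w w' = det2 (w + w') w' by rewrite /det2 /=; ring.
  have w1 : (w + w').1 != 0 by rewrite /= w10 add0r.
  rewrite detE in D0 *; rewrite -wlg//.
  have := @leb2_lower_triangular 1 1 (-1) 0 0
    (plane_affine p (w + w') w' @^-1` E) (oner_neq0 _) (oner_neq0 _).
  rewrite mulr1 normr1 invr1 mul1e => <-; last first.
    by rewrite -[_ @^-1` _]setTI; exact: measurable_plane_affine.
  congr (leb2 _); apply/funext => q; rewrite /= !plane_affineE/=.
  by congr (E (_, _)); ring.
have d0 : det2 w w' / w.1 != 0 by rewrite mulf_neq0// invr_eq0.
have mL : measurable ((fun q : R * R => (1 * q.1 + 0,
    w.2 / w.1 * q.1 + det2 w w' / w.1 * q.2 + (p.2 - w.2 / w.1 * p.1))) @^-1` E).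
  rewrite -[_ @^-1` _]setTI; apply: measurable_fun_pair => //.
    by apply: measurable_funD => //; exact: measurable_funM.
  by apply: measurable_funD => //; apply: measurable_funD => //;
      exact: measurable_funM.
have := leb2_upper_triangular w'.1 p.1 0 w10 (oner_neq0 _) mL.
have -> := leb2_lower_triangular (w.2 / w.1) 0
  (p.2 - w.2 / w.1 * p.1) (oner_neq0 _) d0 mE.
rewrite muleA -EFinM -invfM -normrM.
have -> : w.1 * 1 * (1 * (det2 w w' / w.1)) = det2 w w' by field.
move=> <-; congr (leb2 _); apply/funext => q; rewrite /= !plane_affineE/= /det2.
by congr (E (_, _)); field.
Qed.

End affine_change_of_variables.

(** * Lebesgue differentiation over squares *)

Section generic_lemmas.
Context {R : realType}.

(** Stated for the structure of measures so as to apply to a product measure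
    written as a bare set function. *)
Lemma ae_imply d (T : measurableType d) (mu : {measure set T -> \bar R})
    (P Q : set T) : (forall x, P x -> Q x) ->
  {ae mu, forall x, P x} -> {ae mu, forall x, Q x}.
Proof. by move=> PQ; apply: filterS. Qed.

Lemma ae_imply2 d (T : measurableType d) (mu : {measure set T -> \bar R})
    (P Q S : set T) : (forall x, P x -> Q x -> S x) ->
  {ae mu, forall x, P x} -> {ae mu, forall x, Q x} -> {ae mu, forall x, S x}.
Proof. by move=> PQS; apply: filterS2. Qed.

Lemma negligible_small d (T : measurableType d)
    (mu : {measure set T -> \bar R}) (A : set T) :
  (forall e, 0 < e ->
    exists W, [/\ measurable W, A `<=` W & (mu W <= e%:E)%E]) ->
  mu.-negligible A.
Proof.
move=> small.
have /choice[W WP] : forall n : nat, exists W, [/\ measurable W, A `<=` W &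
    (mu W <= (n.+1%:R^-1)%:E)%E].
  by move=> n; apply: small; rewrite invr_gt0.
have mW : measurable (\bigcap_n W n).
  by apply: bigcapT_measurable => n; have [] := WP n.
exists (\bigcap_n W n); split => //; last first.
  by move=> x Ax n _; have [_ AW _] := WP n; exact: AW.
apply/eqP; rewrite eq_le measure_ge0 andbT; apply/lee_addgt0Pr => e e0.
rewrite add0e; have [n ne] : exists n : nat, n.+1%:R^-1 < e.
  by have [n] := @ltr_add_invr R 0 e e0; rewrite add0r; exists n.
have [mWn _ Wn] := WP n.
apply: le_trans (le_trans Wn _); last by rewrite lee_fin ltW.
by apply: le_measure; rewrite ?inE//; exact: bigcap_inf.
Qed.

Lemma exists_max_seq (I : eqType) (F : I -> R) (s : seq I) : s != [::] ->
  exists2 i, i \in s & forall j, j \in s -> F j <= F i.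
Proof.
elim: s => // i [|j s] IH _.
  by exists i; rewrite ?mem_head// => k; rewrite inE => /eqP ->.
have [//|k ks kmax] := IH.
have [Fik|/ltW Fki] := leP (F i) (F k).
  exists k; first by rewrite inE ks orbT.
  by move=> l; rewrite inE => /predU1P[->//|]; exact: kmax.
exists i; first exact: mem_head.
by move=> l; rewrite inE => /predU1P[->//|/kmax/le_trans]; exact.
Qed.

End generic_lemmas.

Section square_averages.
Context {R : realType}.
Local Notation leb := (leb1 R).
Local Notation leb2 := (leb2 R).
Implicit Types (x y : R * R) (r c : R) (f g : R * R -> R).

(** An open ball for the sup norm, but written as a product so that its measure
    and its intersections with rectangles are immediate. *)
Definition square x r : set (R * R) := ball x.1 r `*` ball x.2 r.

Lemma measurable_square x r : measurable (square x r).
Proof. by apply: measurableX; exact: measurable_ball. Qed.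
#[local] Hint Resolve measurable_square : core.

Lemma leb2_square x r : 0 <= r -> leb2 (square x r) = (4 * r ^+ 2)%:E.
Proof.
move=> r0; rewrite /square product_measure1E; [|exact: measurable_ball..].
by rewrite /= !lebesgue_measure_ball// -EFinM; congr EFin; ring.
Qed.

Lemma ball_triangle_mul3 (a b r s : R) : s <= r ->
  ball a r `&` ball b s !=set0 -> ball b s `<=` ball a (3 * r).
Proof.
rewrite /ball/= => sr [z [az bz]] t bt.
have -> : a - t = (a - z) + (z - b) + (b - t) by ring.
rewrite (le_lt_trans (ler_normD _ _))//
  (le_lt_trans (lerD (ler_normD _ _) (lexx _)))//.
rewrite distrC in bz; rewrite distrC in bz; rewrite [ `|z - b|]distrC; lra.
Qed.

(** The geometric half of the Vitali covering argument: a square that meets a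
    larger one lies in its threefold enlargement. *)
Lemma square_triangle_mul3 x y r s : s <= r ->
  square x r `&` square y s !=set0 -> square y s `<=` square x (3 * r).
Proof.
move=> sr [z [[xz1 xz2] [yz1 yz2]]] t [t1 t2]; split.
  by apply: (ball_triangle_mul3 sr _ t1); exists z.1.
by apply: (ball_triangle_mul3 sr _ t2); exists z.2.
Qed.

(** Induction on the number of squares.  Let [B0] be the largest one.  The
    squares that meet it lie in [3 B0], whose measure is nine times that of
    [B0]; the other ones lie in [U] minus [B0], where the induction hypothesis
    applies.  The bounds add up because the integrals over [B0] and over its
    complement in [U] do. *)
Lemma vitali_squares_finite (h : R * R -> \bar R) c (s : seq (R * R * R))
    (U : set (R * R)) :
  measurable_fun setT h -> (forall x, 0 <= h x)%E -> 0 < c -> measurable U ->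
  (forall B, B \in s -> [/\ 0 < B.2, square B.1 B.2 `<=` U &
    ((c * (4 * B.2 ^+ 2))%:E <= \int[leb2]_(x in square B.1 B.2) h x)%E]) ->
  (c%:E * leb2 (\big[setU/set0]_(B <- s) square B.1 B.2) <=
   9%:E * \int[leb2]_(x in U) h x)%E.
Proof.
move=> mh h0 c0; have [n] := ubnP (size s).
elim: n s U => // n IH s U sn mU sP.
have [->|s_neq0] := eqVneq s [::].
  by rewrite big_nil measure0 mule0 mule_ge0// integral_ge0.
have [B0 B0s B0max] := exists_max_seq snd s_neq0.
have [B0_gt0 B0U B0h] := sP _ B0s.
pose P (B : R * R * R) := `[< square B.1 B.2 `&` square B0.1 B0.2 = set0 >].
pose s' := [seq B <- s | P B].
have mS (t : seq (R * R * R)) :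
    measurable (\big[setU/set0]_(B <- t) square B.1 B.2).
  by apply: bigsetU_measurable => *; exact: measurable_square.
have subs : \big[setU/set0]_(B <- s) square B.1 B.2 `<=`
    square B0.1 (3 * B0.2) `|` \big[setU/set0]_(B <- s') square B.1 B.2.
  rewrite -!bigcup_seq => x [B /= Bs Bx].
  have [PB|nPB] := boolP (P B); first by right; exists B; rewrite //= mem_filter PB.
  left; apply: (square_triangle_mul3 (B0max _ Bs) _ Bx).
  by rewrite setIC; apply/set0P/eqP; move/asboolPn : nPB.
have s's : (size s' < size s)%N.
  rewrite size_filter -(count_predC P s) -[X in (X < _)%N]addn0 ltn_add2l.
  rewrite -has_count; apply/hasP; exists B0 => //=; apply/asboolPn.
  by rewrite setIid => B00; have : set0 B0.1 by
    rewrite -B00; split; exact: ballxx.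
have {IH} := IH s' (U `\` square B0.1 B0.2).
have -> : (size s' < n)%N by apply: leq_trans s's _.
move=> /(_ isT (measurableD mU (measurable_square _ _))).
have s'P B : B \in s' -> [/\ 0 < B.2,
   square B.1 B.2 `<=` U `\` square B0.1 B0.2 &
   ((c * (4 * B.2 ^+ 2))%:E <= \int[leb2]_(x in square B.1 B.2) h x)%E].
  rewrite mem_filter => /andP[/asboolP PB Bs]; have [? BU ?] := sP _ Bs.
  split => // x Bx; split; first exact: BU.
  by move=> B0x; have : set0 x by rewrite -PB.
move=> /(_ s'P) IH.
apply: (@le_trans _ _ (c%:E * (leb2 (square B0.1 (3 * B0.2))%R +
    leb2 (\big[setU/set0]_(B <- s') square B.1 B.2)))%E).
  rewrite lee_pmul2l//; apply: le_trans (measureU2 _ _ _).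
  - apply: le_measure => //; rewrite inE; first exact: mS.
    by apply: measurableU; [exact: measurable_square|exact: mS].
  - exact: measurable_square.
  - exact: mS.
rewrite ge0_muleDr//; apply: le_trans (leeD (lexx _) IH) _.
have UE : U = square B0.1 B0.2 `|` (U `\` square B0.1 B0.2).
  by rewrite setDUK.
rewrite [X in (_ <= _ * \int[_]_(x in X) _)%E]UE ge0_integral_setU//; first last.
- by apply/disj_setPS => x [? []].
- exact: measurable_funTS.
- exact: (measurableD mU (measurable_square _ _)).
- exact: measurable_square.
rewrite [leRHS]ge0_muleDr ?integral_ge0//.
apply: leeD; last exact: lexx.
rewrite leb2_square; last first.
  by rewrite mulr_ge0// ltW.
rewrite -EFinM.
have -> : c * (4 * (3 * B0.2) ^+ 2) = 9 * (c * (4 * B0.2 ^+ 2)) by ring.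
by rewrite EFinM lee_pmul2l.
Qed.

Lemma square_subset x y r s d : square y d x -> r + d <= s ->
  square x r `<=` square y s.
Proof.
case=> y1 y2 rds t [x1 x2]; split;
  rewrite /ball/= in y1 y2 x1 x2 *;
  [rewrite -(subrKA x.1)|rewrite -(subrKA x.2)];
  by rewrite (le_lt_trans (ler_normD _ _))//; lra.
Qed.

Lemma rational_approx x (d : R) : 0 < d ->
  exists q : rat * rat, square (ratr q.1, ratr q.2) d x.
Proof.
move=> d0.
have h (a : R) : exists q : rat, `|ratr q - a| < d.
  have [|q] := @rat_in_itvoo R (a - d) (a + d); first lra.
  by rewrite in_itv/= -ltr_distlC distrC => qd; exists q.
by have [q1 ?] := h x.1; have [q2 ?] := h x.2; exists (q1, q2).
Qed.

(** Hardy-Littlewood maximal inequality of weak type.  Since the average over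
    the square is strictly larger than [c], it can be enlarged a little so as
    to have a rational centre and radius.  The set is thus covered by countably
    many squares, and the bound for finitely many of them passes to the limit.
    The covering set [W] spares the measurability of the maximal function. *)
Lemma maximal_inequality_squares (h : R * R -> \bar R) c :
  leb2.-integrable setT h -> (forall x, 0 <= h x)%E -> 0 < c ->
  exists W : set (R * R), [/\ measurable W,
    (c%:E * leb2 W <= 9%:E * \int[leb2]_x h x)%E &
    forall x r, 0 < r ->
      ((c * (4 * r ^+ 2))%:E < \int[leb2]_(y in square x r) h y)%E -> W x].
Proof.
move=> ih h0 c0; have mh := measurable_int _ ih.
pose sq (q : rat * rat * rat) :=
  ((ratr q.1.1, ratr q.1.2) : R * R, ratr q.2 : R).
pose good (q : rat * rat * rat) := `[< 0 < (sq q).2 /\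
  ((c * (4 * (sq q).2 ^+ 2))%:E <=
    \int[leb2]_(x in square (sq q).1 (sq q).2) h x)%E >].
pose s n := [seq q <- pmap unpickle (iota 0 n) | good q].
pose F n := \big[setU/set0]_(B <- map sq (s n)) square B.1 B.2.
have mF n : measurable (F n).
  by apply: bigsetU_measurable => *; exact: measurable_square.
have mUF : measurable (\bigcup_n F n) by exact: bigcup_measurable.
exists (\bigcup_n F n); split => //.
- have : (c%:E * leb2 (F n))%E @[n --> \oo] --> (c%:E * leb2 (\bigcup_n F n))%E.
    apply: cvgeZl => //; apply: nondecreasing_cvg_mu => // m n mn.
    apply/subsetPset => x; rewrite /F -!bigcup_seq => -[B /= Bs Bx].
    exists B => //=; move/mapP : Bs => [q qs ->]; apply/mapP; exists q => //.
    move: qs; rewrite !mem_filter => /andP[-> /=]; rewrite !mem_pmap.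
    move=> /mapP[k]; rewrite mem_iota => /andP[_ km] ->; apply/mapP; exists k => //.
    by rewrite mem_iota/= (leq_trans km).
  move=> cvF; apply: (cvge_le _ cvF); apply: nearW => n /=.
  apply: vitali_squares_finite => // B /mapP[q + ->].
  by rewrite mem_filter => /andP[/asboolP[? ?] _]; split.
- move=> x r r0 cI.
  have [rho r_rho rhoI] : exists2 rho, r < rho &
      ((c * (4 * rho ^+ 2))%:E <= \int[leb2]_(y in square x r) h y)%E.
    have Ifin : (\int[leb2]_(y in square x r) h y)%E \is a fin_num.
      by apply: integrable_fin_num; [exact: measurable_square|
        apply: integrableS ih => //; exact: measurable_square].
    rewrite -(fineK Ifin) lte_fin in cI.
    have c4 : 0 < c * 4 by rewrite mulr_gt0.
    have I0 : 0 < fine (\int[leb2]_(y in square x r) h y)%E.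
      by rewrite (le_lt_trans _ cI)// mulr_ge0 ?ltW// mulr_gt0// exprn_gt0.
    (* the radius for which the inequality becomes an equality *)
    exists (Num.sqrt (fine (\int[leb2]_(y in square x r) h y)%E / (c * 4))).
      rewrite -[ltLHS]gtr0_norm// -sqrtr_sqr ltr_sqrt ?divr_gt0//.
      by rewrite ltr_pdivlMr// mulrC -mulrA.
    rewrite -[leRHS](fineK Ifin) lee_fin sqr_sqrtr.
      by rewrite mulrA mulrCA divff ?mulr1// gt_eqF.
    by rewrite divr_ge0// ltW.
  have [|q xq] := @rational_approx x ((rho - r) / 2); first lra.
  have [|t] := @rat_in_itvoo R (r + (rho - r) / 2) rho; first lra.
  rewrite in_itv/= => /andP[rt trho].
  have gqt : good (q, t).
    apply/asboolP; split; rewrite [(sq _).2]/=; first lra.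
    apply: (@le_trans _ _ (c * (4 * rho ^+ 2))%:E).
      by rewrite lee_fin ler_pM2l// ler_pM2l// ler_sqr ?nnegrE ?ltW//; lra.
    apply: (le_trans rhoI); apply: ge0_subset_integral => //.
    - exact: measurable_square.
    - exact: measurable_square.
    - exact: measurable_funTS.
    - exact: (square_subset xq (ltW rt)).
  have sqx : square (sq (q, t)).1 (sq (q, t)).2 x.
    by apply: (square_subset xq (ltW rt)); split; exact: ballxx.
  move: (q, t) gqt sqx => qt gqt sqx.
  exists (pickle qt).+1 => //; rewrite /F -bigcup_seq; exists (sq qt) => //.
  apply: map_f; rewrite mem_filter gqt mem_pmap; apply/mapP.
  by exists (pickle qt); rewrite ?pickleK// mem_iota/=.
Qed.

Definition avg f x r : R :=
  (4 * r ^+ 2)^-1 * \int[leb2]_(y in square x r) f y.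

(** Convergence of the averages themselves rather than of the averages of
    [`|f y - f x|]: it is linear in [f]. *)
Definition average_point f x := avg f x r @[r --> 0^'+] --> f x.

Definition differentiable_ae f := leb2.-integrable setT (EFin \o f) /\
  {ae leb2, forall x, average_point f x}.

Lemma integrable_square f x r : leb2.-integrable setT (EFin \o f) ->
  leb2.-integrable (square x r) (EFin \o f).
Proof. by apply: integrableS => //; exact: measurable_square. Qed.

Lemma avgB f g x r : leb2.-integrable setT (EFin \o f) ->
  leb2.-integrable setT (EFin \o g) ->
  avg (f \- g) x r = avg f x r - avg g x r.
Proof.
move=> If Ig; rewrite /avg RintegralB ?mulrBr//.
- exact: measurable_square.
- exact: integrable_square.
- exact: integrable_square.
Qed.

Lemma avgD f g x r : leb2.-integrable setT (EFin \o f) ->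
  leb2.-integrable setT (EFin \o g) ->
  avg (f \+ g) x r = avg f x r + avg g x r.
Proof.
move=> If Ig; rewrite /avg RintegralD ?mulrDr//.
- exact: measurable_square.
- exact: integrable_square.
- exact: integrable_square.
Qed.

Lemma avgZ (k : R) f x r : leb2.-integrable setT (EFin \o f) ->
  avg (fun y => k * f y) x r = k * avg f x r.
Proof.
move=> If; rewrite /avg RintegralZl 1?mulrCA//.
- exact: measurable_square.
- exact: integrable_square.
Qed.

Lemma le_avg_norm f x r c : leb2.-integrable setT (EFin \o f) -> 0 < r ->
  (\int[leb2]_(y in square x r) `|(f y)%:E| <= (c * (4 * r ^+ 2))%:E)%E ->
  `|avg f x r| <= c.
Proof.
move=> If r0 fc; have r2 : 0 < 4 * r ^+ 2 by rewrite mulr_gt0// exprn_gt0.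
rewrite /avg normrM [X in X * _]ger0_norm; last by rewrite invr_ge0 ltW.
rewrite ler_pdivrMl// mulrC.
have Ifx := integrable_square x r If.
apply: (le_trans (le_normr_Rintegral _ Ifx)); first exact: measurable_square.
rewrite -lee_fin fineK// integrable_fin_num//; first exact: measurable_square.
exact: (integrable_norm Ifx).
Qed.

Lemma differentiable_aeB f g : differentiable_ae f -> differentiable_ae g ->
  differentiable_ae (f \- g).
Proof.
move=> [If Df] [Ig Dg]; split.
  rewrite (_ : _ \o _ = (fun x => (f x)%:E - (g x)%:E)%E)//.
  exact: integrableB.
apply: ae_imply2 Df Dg => x fx gx; rewrite /average_point.
under eq_fun do rewrite avgB//.
exact: cvgB.
Qed.

Lemma differentiable_aeD f g : differentiable_ae f -> differentiable_ae g ->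
  differentiable_ae (f \+ g).
Proof.
move=> [If Df] [Ig Dg]; split.
  rewrite (_ : _ \o _ = (fun x => (f x)%:E + (g x)%:E)%E)//.
  exact: integrableD.
apply: ae_imply2 Df Dg => x fx gx; rewrite /average_point.
under eq_fun do rewrite avgD//.
exact: cvgD.
Qed.

Lemma differentiable_aeZ (k : R) f : differentiable_ae f ->
  differentiable_ae (fun x => k * f x).
Proof.
move=> [If Df]; split.
  rewrite (_ : _ \o _ = (fun x => k%:E * (f x)%:E)%E)//.
  exact: integrableZl.
apply: ae_imply Df => x fx; rewrite /average_point.
under eq_fun do rewrite avgZ//.
by apply: cvgM => //; exact: cvg_cst.
Qed.

Lemma differentiable_ae0 : differentiable_ae (fun=> 0).
Proof.
split; first exact: integrable0.
apply: aeW => x; rewrite /average_point.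
have -> : avg (fun=> 0) x = (fun=> 0).
  by apply/funext => r; rewrite /avg /Rintegral integral0 mulr0.
exact: cvg_cst.
Qed.

(** If [g] is close to [f] in L1, then
    [avg f - f = avg (f - g) + (avg g - g) + (g - f)].  The first term is at
    most [eta] outside a set [W] of small measure by the maximal inequality,
    the last one outside a set [V] of small measure by the Markov inequality,
    and the middle one tends to 0 almost everywhere.  So the set where the
    averages stay [3 eta] away from [f] lies in sets of arbitrarily small
    measure. *)
Lemma differentiable_ae_L1_closed f : leb2.-integrable setT (EFin \o f) ->
  (forall e, 0 < e -> exists2 g, differentiable_ae g &
     (\int[leb2]_x `|(f x - g x)%:E| <= e%:E)%E) ->
  differentiable_ae f.
Proof.
move=> If fapprox; split => //.
pose N (k : nat) := [set x | ~ exists2 d, 0 < d &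
   forall r, 0 < r -> r < d -> `|f x - avg f x r| <= k.+1%:R^-1].
suff NN k : leb2.-negligible (N k).
  apply: negligibleS (negligible_bigcup NN) => x /= nfx.
  apply: contrapT => nN; apply: nfx; apply/cvgrPdist_le => e e0.
  have [n] := @ltr_add_invr R 0 e e0; rewrite add0r => ne.
  have [d d0 dP] : exists2 d, 0 < d & forall r, 0 < r -> r < d ->
      `|f x - avg f x r| <= n.+1%:R^-1.
    by apply: contrapT => nd; apply: nN; exists n.
  near=> r; apply: (le_trans (dP r _ _)); last exact: ltW.
    by near: r; exact: nbhs_right_gt.
  by near: r; exact: nbhs_right_lt.
apply: negligible_small => e e0.
pose eta : R := k.+1%:R^-1 / 3.
have eta0 : 0 < eta by rewrite divr_gt0// invr_gt0.
have [|g [Ig [Ng [mNg Ng0 gNg]]] fg] := fapprox (e * eta / 10).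
  by rewrite divr_gt0// mulr_gt0.
have Ifg : leb2.-integrable setT (fun x => (f x - g x)%:E).
  by under eq_fun do rewrite EFinB; exact: integrableB.
have mfg : measurable_fun setT (fun x => (f x - g x)%:E) := measurable_int _ Ifg.
have Ifg' : leb2.-integrable setT (fun x => `|(f x - g x)%:E|)%E.
  exact: integrable_abse.
have [W [mW W9 WP]] := maximal_inequality_squares Ifg' (fun x => abse_ge0 _) eta0.
pose V := [set x | (eta%:E <= `|(f x - g x)%:E|)%E].
have mV : measurable V.
  rewrite -[V]setTI; apply: emeasurable_fun_c_infty => //.
  exact: measurable_int Ifg'.
have V1 : (eta%:E * leb2 V <= \int[leb2]_x `|(f x - g x)%:E|)%E.
  by rewrite -[V]setTI; exact: le_integral_abse.
exists (W `|` V `|` Ng); split.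
- by apply: measurableU => //; exact: measurableU.
- move=> x; apply: contra_notP => /not_orP[/not_orP[nWx nVx] nNgx].
  have /cvgrPdist_le/(_ _ eta0) : average_point g x.
    by apply: contrapT => ngx; apply: nNgx; exact: gNg.
  move=> [d /= d0 dP]; exists d => // r r0 rd.
  have gr : `|g x - avg g x r| <= eta.
    apply: dP => //=; rewrite sub0r normrN gtr0_norm//.
  have fgx : `|f x - g x| <= eta.
    by rewrite leNgt; apply/negP => fgx; apply: nVx; rewrite /V/= lee_fin ltW.
  have afg : `|avg (f \- g) x r| <= eta.
    apply: le_avg_norm => //; rewrite leNgt; apply/negP => fgr.
    by apply: nWx; exact: WP fgr.
  rewrite avgB// in afg.
  rewrite (_ : f x - _ = (f x - g x) + (g x - avg g x r) -
    (avg f x r - avg g x r)); last by ring.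
  rewrite (le_trans (ler_normB _ _))//.
  have := ler_normD (f x - g x) (g x - avg g x r).
  have -> : k.+1%:R^-1 = eta * 3 by rewrite /eta divfK.
  lra.
- have h10 : (eta%:E * leb2 (W `|` V `|` Ng) <= eta%:E * e%:E)%E.
    apply: (@le_trans _ _ (eta%:E * (leb2 W + leb2 V))%E).
      rewrite lee_pmul2l// -[leRHS]adde0 -[X in (_ <= _ + X)%E]Ng0.
      apply: le_trans (measureU2 _ _ _) _ => //; first exact: measurableU.
      by apply: leeD => //; exact: measureU2.
    rewrite ge0_muleDr//; apply: (le_trans (leeD W9 V1)).
    rewrite -[X in (_ + X)%E]mul1e -ge0_muleDl// -EFinD.
    apply: (@le_trans _ _ ((9 + 1)%:E * (e * eta / 10)%:E)%E).
      by rewrite lee_pmul2l//.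
    by rewrite -!EFinM lee_fin; lra.
  by rewrite lee_pmul2l// in h10.
Unshelve. all: by end_near. Qed.

End square_averages.
Section differentiable_ae_L1.
Context {R : realType}.
Local Notation leb := (leb1 R).
Local Notation leb2 := (leb2 R).
Implicit Types (x y : R * R) (r c : R) (f g : R * R -> R).

Lemma integrable_indic_fin (E : set (R * R)) : measurable E ->
  (leb2 E < +oo)%E -> leb2.-integrable setT (EFin \o \1_E).
Proof.
move=> mE Efin; apply/integrableP; split.
  by apply/measurable_EFinP; exact: measurable_indic.
under eq_integral do rewrite /= ger0_norm//.
by rewrite integral_indic// setIT.
Qed.

Lemma avg_indic (E : set (R * R)) x r : measurable E ->
  avg \1_E x r = (4 * r ^+ 2)^-1 * fine (leb2 (E `&` square x r)).
Proof.
move=> mE; rewrite /avg /Rintegral integral_indic//.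
exact: measurable_square.
Qed.

Lemma ae_fst_snd (P Q : set R) : {ae leb, forall a, P a} ->
  {ae leb, forall a, Q a} -> {ae leb2, forall x, P x.1 /\ Q x.2}.
Proof.
move=> [N [mN N0 PN]] [M [mM M0 QM]].
exists ((N `*` setT) `|` (setT `*` M)); split.
- by apply: measurableU; exact: measurableX.
- apply: null_set_setU; [exact: measurableX|exact: measurableX|..].
    by rewrite /= product_measure1E// [X in (X * _)%E]N0 mul0e.
  by rewrite /= product_measure1E// [X in (_ * X)%E]M0 mule0.
- move=> x /= /not_andP[nP|nQ]; [left; split => //; exact: PN|].
  by right; split => //; exact: QM.
Qed.

Lemma lebesgue_density_fine (A : set R) : measurable A ->
  {ae leb, forall a, fine (leb (A `&` ball a r)) / (2 * r) @[r --> 0^'+] -->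
    (\1_A a : R)}.
Proof.
move=> mA; apply: ae_imply (lebesgue_density mA) => a /fine_cvg.
apply: cvg_trans; apply: near_eq_cvg; near=> r.
have r0 : 0 < r by near: r; exact: nbhs_right_gt.
have mball : measurable (ball a r) by exact: measurable_ball.
rewrite /= lebesgue_measure_ball ?ltW// inver gt_eqF ?mulrn_wgt0//.
rewrite fineM//=; first by rewrite mulr_natl.
rewrite ge0_fin_numE// (@le_lt_trans _ _ (leb (ball a r)))//.
  by apply: le_measure; rewrite ?inE//; exact: measurableI.
by rewrite lebesgue_measure_ball ?ltry// ltW.
Unshelve. all: by end_near. Qed.

(** The averages of the indicator of a rectangle are products of
    one-dimensional densities, to which the Lebesgue density theorem applies. *)
Lemma differentiable_ae_rectangle (A B : set R) :
  measurable A -> measurable B ->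
  (leb A < +oo)%E -> (leb B < +oo)%E -> differentiable_ae (\1_(A `*` B)).
Proof.
move=> mA mB Afin Bfin; split.
  apply: integrable_indic_fin; first exact: measurableX.
  by rewrite product_measure1E// lte_mul_pinfty// ge0_fin_numE.
have := ae_fst_snd (lebesgue_density_fine mA) (lebesgue_density_fine mB).
apply: ae_imply => x [xA xB].
have avgE : avg \1_(A `*` B) x = fun r =>
    fine (leb (A `&` ball x.1 r)) / (2 * r) *
    (fine (leb (B `&` ball x.2 r)) / (2 * r)).
  apply/funext => r; rewrite avg_indic; last exact: measurableX.
  rewrite /square -setXI product_measure1E; last 2 first.
    by apply: measurableI => //; exact: measurable_ball.
    by apply: measurableI => //; exact: measurable_ball.
  rewrite fineM; last 2 first.
  - rewrite ge0_fin_numE// (le_lt_trans _ Afin)//.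
    by apply: le_measure; rewrite ?inE//; apply: measurableI => //;
      exact: measurable_ball.
  - rewrite ge0_fin_numE// (le_lt_trans _ Bfin)//.
    by apply: le_measure; rewrite ?inE//; apply: measurableI => //;
      exact: measurable_ball.
  rewrite mulrACA -invfM mulrC; congr (_ / _); ring.
have indicE2 : \1_(A `*` B) x = \1_A x.1 * \1_B x.2 :> R.
  by rewrite !indicE in_setX -natrM mulnb.
rewrite /average_point avgE indicE2; exact: cvgM.
Qed.

Lemma cvge0_near_le (u : nat -> \bar R) (e : R) : u n @[n --> \oo] --> 0%E ->
  0 < e -> \forall n \near \oo, (u n <= e%:E)%E.
Proof.
move=> u0 e0; have : nbhs (0%E : \bar R) [set x | (x < e%:E)%E].
  by apply: open_nbhs_nbhs; split; [exact: open_ereal_lt_ereal|rewrite /= lte_fin].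
move=> /u0 ue; near=> n; apply: ltW; near: n; exact: ue.
Unshelve. all: by end_near. Qed.

Lemma differentiable_ae_dominated f (f_ : nat -> R * R -> R)
    (h : R * R -> \bar R) :
  (forall n, differentiable_ae (f_ n)) -> measurable_fun setT f ->
  (forall x, f_ n x @[n --> \oo] --> f x) ->
  leb2.-integrable setT h -> (forall n x, (`|(f_ n x)%:E| <= h x)%E) ->
  differentiable_ae f.
Proof.
move=> Df_ mf f_f ih f_h.
have [|||||If + _] := @dominated_convergence _ _ _ leb2 setT measurableT
    (fun n x => (f_ n x)%:E) (EFin \o f) h.
- by move=> n; have [/measurable_int] := Df_ n.
- exact/measurable_EFinP.
- by apply: aeW => x _; apply: cvg_EFin; [exact: nearW|exact: f_f].
- by [].
- by apply: aeW => x n _; exact: f_h.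
move=> L1; apply: differentiable_ae_L1_closed => // e e0.
have [N _ NP] : \forall n \near \oo,
    (\int[leb2]_x `|(f_ n x)%:E - (f x)%:E| <= e%:E)%E.
  exact: (cvge0_near_le L1 e0).
exists (f_ N) => //; apply: le_trans (NP N (leqnn N)).
rewrite le_eqVlt; apply/orP; left; apply/eqP; apply: eq_integral => x _.
by rewrite -EFinB /= distrC.
Qed.

Lemma indicU_disjoint (T : Type) (A B : set T) : A `&` B = set0 ->
  \1_(A `|` B) = \1_A \+ \1_B :> (T -> R).
Proof.
move=> AB0; apply/funext => x; rewrite /= !indicE in_setU.
have : ~~ ((x \in A) && (x \in B)) by rewrite -in_setI AB0 in_set0.
by case: (x \in A); case: (x \in B); rewrite //= ?addr0 ?add0r.
Qed.

Lemma indicC_in (T : Type) (A B : set T) :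
  \1_(~` A `&` B) = \1_B \- \1_(A `&` B) :> (T -> R).
Proof.
apply/funext => x; rewrite /= !indicE !in_setI in_setC.
by case: (x \in A); case: (x \in B); rewrite //= ?subr0 ?subrr.
Qed.

Local Notation box n := (square ((0, 0) : R * R) n%:R).

(** The measurable sets for which this holds form a Dynkin system, stable under
    disjoint unions by dominated convergence, and it contains the rectangles.
    The box keeps the measures finite. *)
Lemma differentiable_ae_indic (E : set (R * R)) n : measurable E ->
  differentiable_ae \1_(E `&` box n).
Proof.
pose G := [set A `*` B | A in @measurable _ R & B in @measurable _ R].
have leb_ball : (leb (ball (0%R : R) n%:R) < +oo)%E.
  by rewrite lebesgue_measure_ball ?ltry.
have DG (A B : set R) : measurable A -> measurable B ->
    differentiable_ae \1_(A `*` B `&` box n).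
  move=> mA mB; rewrite /square -setXI.
  have mball : measurable (ball (0%R : R) n%:R) by exact: measurable_ball.
  by apply: differentiable_ae_rectangle; [exact: measurableI|exact: measurableI|
    apply: le_lt_trans leb_ball; apply: le_measure; rewrite ?inE//;
    exact: measurableI..].
have DT : differentiable_ae \1_(setT `&` box n) 
  by have := DG setT setT measurableT measurableT; rewrite setXTT; apply.
move=> mE; have := mE; rewrite measurable_prod_measurableType.
apply: (@dynkin_induction _ _ _ (fun E => differentiable_ae \1_(E `&` box n))).
- exact: measurable_prod_measurableType.
- move=> _ _ [A mA [B mB <-]] [A' mA' [B' mB' <-]]; rewrite -setXI.
  by exists (A `&` A'); [exact: measurableI|exists (B `&` B') => //; exact: measurableI].
- exact: DT.
- by move=> _ [A mA [B mB <-]]; exact: DG.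
- move=> S mS DS; rewrite indicC_in; apply: differentiable_aeB => //.
  by rewrite -[box n]setTI.
- move=> F mF tF DF.
  pose H N := \big[setU/set0]_(k < N) F k `&` box n.
  have DH N : differentiable_ae \1_(H N).
    elim: N => [|N IH].
      by rewrite /H big_ord0 set0I indic0; exact: differentiable_ae0.
    rewrite /H big_ord_recr /= setIUl indicU_disjoint.
      exact: differentiable_aeD.
    rewrite setIACA setIid; apply/seteqP; split => // x [[]].
    rewrite -bigcup_mkord => -[k /= kN Fkx] FNx _.
    have := (@trivIsetP _ _ _ _).1 tF k N I I.
    rewrite (ltn_eqF kN) => /(_ isT) => FF.
    by have : (F k `&` F N) x by []; rewrite FF.
  apply: (differentiable_ae_dominated DH (h := EFin \o \1_(box n))).
  + apply: measurable_indic; apply: measurableI; last exact: measurable_square.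
    exact: bigcupT_measurable.
  + move=> x; apply: cvg_near_cst.
    have [[[k _ Fkx] bx]|nx] := pselect ((\bigcup_k F k `&` box n) x).
      near=> N; rewrite !indicE !mem_set//; first by split => //; exists k.
      split => //; rewrite -bigcup_mkord; exists k => //=.
      by near: N; exact: nbhs_infty_gt.
    apply: nearW => N; rewrite !indicE !memNset//.
    by move=> [+ bx]; rewrite -bigcup_mkord => -[k _ Fkx]; apply: nx; split => //; exists k.
  + by have [] := DT; rewrite setTI.
  + move=> N x; rewrite lee_fin /= ger0_norm// !indicE ler_nat in_setI.
    by case: (_ \in _) => //=; case: (_ \in _).
Unshelve. all: by end_near. Qed.

Import HBSimple.

(** Simple functions cut off by boxes are finite combinations of indicators; the
    L1 closure removes the cut-off and then reaches all integrable functions. *)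
Theorem plane_lebesgue_differentiation f :
  leb2.-integrable setT (EFin \o f) -> {ae leb2, forall x, average_point f x}.
Proof.
move=> If; suff [] : differentiable_ae f by [].
have Dbox (g : {sfun (measurableTypeR R * measurableTypeR R)%type >-> R}) n :
    differentiable_ae (fun x => g x * \1_(box n) x).
  have -> : (fun x => g x * \1_(box n) x) = (fun x =>
      \sum_(y \in range g) y * \1_(g @^-1` [set y] `&` box n) x).
    apply/funext => x; rewrite {1}fimfunE !fsbig_finite//= mulr_suml.
    by apply: eq_bigr => y _; rewrite -mulrA !indicE in_setI -natrM mulnb.
  under eq_fun do rewrite fsbig_finite//.
  elim: (finmap.enum_fset _) => [|y s IH].
    by under eq_fun do rewrite big_nil; exact: differentiable_ae0.
  under eq_fun do rewrite big_cons; apply: differentiable_aeD => //.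
  apply: differentiable_aeZ; apply: differentiable_ae_indic.
  exact: (measurable_funPTI g (measurable_set1 y)).
have Dg (g : {sfun (measurableTypeR R * measurableTypeR R)%type >-> R}) :
    leb2.-integrable setT (EFin \o g) ->
    differentiable_ae g.
  move=> Ig; apply: (differentiable_ae_dominated (Dbox g) (h := abse \o (EFin \o g))).
  - exact: (measurable_funP g).
  - move=> x; apply: cvg_near_cst; near=> n; rewrite indicE mem_set ?mulr1//.
    split; rewrite /ball/= sub0r normrN; near: n; exact: nbhs_infty_gtr.
  - exact: integrable_abse.
  - move=> n x; rewrite lee_fin normrM ler_piMr// indicE.
    by case: (_ \in _); rewrite ?normr1 ?normr0.
have [g_ [Ig_ _ g_f]] := approximation_sfun_integrable measurableT If.
apply: differentiable_ae_L1_closed => // e e0.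
have [N _ NP] : \forall n \near \oo,
    (\int[leb2]_x `|(f x)%:E - (g_ n x)%:E| <= e%:E)%E.
  exact: (cvge0_near_le g_f e0).
by exists (g_ N); [exact: Dg|exact: (NP N (leqnn N))].
Unshelve. all: by end_near. Qed.

End differentiable_ae_L1.

(** * Ray integrals and the axial integral as plane integrals *)

Section fubini_rectangles.
Context {R : realType}.
Local Notation leb := (leb1 R).
Local Notation leb2 := (leb2 R).
Implicit Types (h : R * R -> R) (I J : set R).

Lemma integrable_fine d (T : measurableType d) (mu : {measure set T -> \bar R})
    (F : T -> \bar R) : mu.-integrable setT F ->
  mu.-integrable setT (fun x => (fine (F x))%:E).
Proof.
move=> iF; apply: le_integrable (iF) => //.
  by apply/measurable_EFinP; exact: measurableT_comp (measurable_int _ iF).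
by move=> x _; case: (F x) => [r| |]; rewrite /= ?normr0 ?leey.
Qed.

Lemma integrable_restrict d (T : measurableType d)
    (mu : {measure set T -> \bar R}) (f : T -> R) (D : set T) : measurable D ->
  mu.-integrable setT (EFin \o f) -> mu.-integrable setT (EFin \o (f \_ D)).
Proof.
move=> mD If; rewrite -restrict_EFin; apply: (integrable_mkcond _ mD).1.
exact: integrableS If.
Qed.

Lemma ae_integrable_fst h J : leb2.-integrable setT (EFin \o h) ->
  measurable J ->
  {ae leb, forall t, leb.-integrable J (fun s => (h (t, s))%:E)}.
Proof.
move=> ih mJ; apply: ae_imply (ae_integrable1 ih) => t.
by apply: integrableS.
Qed.

(** Fubini for the section integrals as real numbers.  As extended real numbers
    they are finite almost everywhere, and [fine] changes nothing there. *)
Lemma integrable_Rintegral_fst h I J : leb2.-integrable setT (EFin \o h) ->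
  measurable I -> measurable J ->
  leb.-integrable I (fun t => (\int[leb]_(s in J) h (t, s))%:E).
Proof.
move=> ih mI mJ.
have mIJ : measurable ([set: R] `*` J) by exact: measurableX.
have ik : leb2.-integrable setT (EFin \o (h \_ (setT `*` J))).
  exact: integrable_restrict.
rewrite (_ : (fun t => _) = (fun t =>
    (fine (fubini_F leb (EFin \o (h \_ (setT `*` J))) t))%:E)).
  apply: (integrableS measurableT) => //.
  exact: integrable_fine (integrable_fubini_F ik).
apply/funext => t; congr EFin.
rewrite /fubini_F /Rintegral [in LHS]integral_mkcond; congr fine.
apply: eq_integral => s _; rewrite /= !patchE.
have -> : ((t, s) \in [set: R] `*` J) = (s \in J).
  by rewrite in_setX in_setT.
by case: ifP.
Qed.

Lemma Rintegral_Rintegral_fst h I J : leb2.-integrable setT (EFin \o h) ->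
  measurable I -> measurable J ->
  \int[leb]_(t in I) \int[leb]_(s in J) h (t, s) =
  \int[leb2]_(q in I `*` J) h q.
Proof.
move=> ih mI mJ.
have mIJ : measurable (I `*` J) by exact: measurableX.
pose k := h \_ (I `*` J).
have ik : leb2.-integrable setT (EFin \o k).
  exact: integrable_restrict.
rewrite Rintegral_mkcond [RHS]Rintegral_mkcond /Rintegral; congr fine.
have iF := integrable_fubini_F ik.
transitivity (\int[leb]_t fubini_F leb (EFin \o k) t)%E; last first.
  by rewrite integral12_prod_meas1.
have FE : (fun t => (((fun t => \int[leb]_(s in J) h (t, s)) \_ I) t)%:E) =
   (fun t => (fine (fubini_F leb (EFin \o k) t))%:E).
  apply/funext => t; congr EFin; rewrite patchE /fubini_F /k.
  case: ifPn => [tI|tI].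
    rewrite /Rintegral [in LHS]integral_mkcond; congr fine.
    apply: eq_integral => s _; rewrite /= !patchE in_setX tI /=.
    by case: ifP.
  rewrite integral0_eq// => s _.
  by rewrite /= patchE in_setX (negbTE tI).
rewrite FE; apply: ae_eq_integral => //.
- exact: (measurable_int _ (integrable_fine iF)).
- exact: (measurable_int _ iF).
- apply: ae_imply (integrable_ae measurableT iF) => t Ft _.
  by rewrite fineK//; exact: Ft.
Qed.

End fubini_rectangles.

Section plane_affine_integral.
Context {R : realType}.
Local Notation leb := (leb1 R).
Local Notation leb2 := (leb2 R).
Implicit Types (f : R * R -> R) (p w q : R * R).

Lemma integrable_plane_affine f p w w' : det2 w w' != 0 ->
  leb2.-integrable setT (EFin \o f) ->
  leb2.-integrable setT (EFin \o (f \o plane_affine p w w')).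
Proof.
move=> D0.
apply: (@integrable_scaling_map _ _ R leb2 (plane_affine p w w')
  `|det2 w w'|^-1).
- by rewrite invr_ge0.
- exact: measurable_plane_affine.
- by move=> A mA; exact: leb2_plane_affine.
Qed.

Lemma Rintegral_plane_affine f p w w' (S : set (R * R)) : det2 w w' != 0 ->
  leb2.-integrable setT (EFin \o f) -> measurable S ->
  \int[leb2]_(q in plane_affine p w w' @^-1` S) f (plane_affine p w w' q) =
  `|det2 w w'|^-1 * \int[leb2]_(q in S) f q.
Proof.
move=> D0 If mS; rewrite Rintegral_mkcond [in RHS]Rintegral_mkcond.
have IfS : leb2.-integrable setT (EFin \o (f \_ S)).
  exact: integrable_restrict.
have -> : ((fun q => f (plane_affine p w w' q)) \_
    (plane_affine p w w' @^-1` S)) = (f \_ S) \o plane_affine p w w'.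
  by apply/funext => q; rewrite /= !patchE.
rewrite /Rintegral.
rewrite (@integral_scaling_map _ _ R leb2 (plane_affine p w w')
  `|det2 w w'|^-1 _ _ _ (EFin \o (f \_ S)))//.
- by rewrite fineM// integrable_fin_num.
- exact: measurable_plane_affine.
- by move=> A mA; exact: leb2_plane_affine.
Qed.

Lemma ae_plane_affine (P : set (R * R)) p w w' : det2 w w' != 0 ->
  {ae leb2, forall q, P q} -> {ae leb2, forall q, P (plane_affine p w w' q)}.
Proof.
move=> D0; apply: (@ae_scaling_map _ _ R leb2 (plane_affine p w w')
  `|det2 w w'|^-1).
- exact: measurable_plane_affine.
- by move=> A mA; exact: leb2_plane_affine.
Qed.

End plane_affine_integral.

Section ray_integrals.
Context {R : realType}.
Local Notation leb := (leb1 R).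
Local Notation leb2 := (leb2 R).
Implicit Types (f : R * R -> R) (p u v w : R * R).

Lemma ae_ray_integrable f p w w' : det2 w w' != 0 ->
  leb2.-integrable setT (EFin \o f) ->
  {ae leb, forall t, ray_integrable f w' (p + t *: w)}.
Proof.
move=> D0 If; apply: ae_integrable_fst (integrable_plane_affine p D0 If) _.
exact: measurable_itv.
Qed.

Lemma ray_integrable_ray_integral f p w w' : det2 w w' != 0 ->
  leb2.-integrable setT (EFin \o f) -> ray_integrable (ray_integral f w') w p.
Proof.
move=> D0 If.
exact: (integrable_Rintegral_fst (integrable_plane_affine p D0 If)).
Qed.

Lemma vline_axis_defined_L1 f u v p : det2 (bisector u v) u != 0 ->
  det2 (bisector u v) v != 0 -> leb2.-integrable setT (EFin \o f) ->
  vline_axis_defined f u v p.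
Proof.
move=> Du Dv If; split.
  apply: ae_imply2 (ae_ray_integrable p Du If) (ae_ray_integrable p Dv If).
  by move=> t ? ? _; split.
have Iu := ray_integrable_ray_integral p Du If.
have Iv := ray_integrable_ray_integral p Dv If.
rewrite /ray_integrable in Iu Iv *.
rewrite (_ : (fun t => _) = (fun t => (ray_integral f u (p + t *: bisector u v))%:E
  + (ray_integral f v (p + t *: bisector u v))%:E)%E)//.
by apply: integrableD => //; exact: measurable_itv.
Qed.

End ray_integrals.
Section quadrants.
Context {R : realType}.
Local Notation leb := (leb1 R).
Local Notation leb2 := (leb2 R).
Implicit Types (f g : R * R -> R) (p u v w x : R * R) (I J : set R).

(** With [x = 0], the coordinates in the frame [(p; u, v)] of the sector of
    vertex [p] spanned by the two branches. *)
Definition quadrant x : set (R * R) := `[x.1, +oo[ `*` `[x.2, +oo[.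

Lemma measurable_quadrant x : measurable (quadrant x).
Proof. by apply: measurableX; exact: measurable_itv. Qed.

Lemma quadrantP x q : quadrant x q <-> x.1 <= q.1 /\ x.2 <= q.2.
Proof. by rewrite /quadrant /= !in_itv/= !andbT. Qed.

Lemma Rintegral_setD_null d (T : measurableType d)
    (mu : {measure set T -> \bar R}) (D N : set T) (h : T -> R) :
  measurable D -> measurable N -> mu N = 0%E ->
  mu.-integrable D (EFin \o h) ->
  \int[mu]_(x in D) h x = \int[mu]_(x in D `\` N) h x.
Proof. by move=> mD mN N0 ih; rewrite /Rintegral -negligible_integral. Qed.

Lemma Rintegral_setB d (T : measurableType d)
    (mu : {measure set T -> \bar R}) (A B : set T) (h : T -> R) :
  measurable A -> measurable B -> B `<=` A -> mu.-integrable setT (EFin \o h) ->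
  \int[mu]_(x in A) h x - \int[mu]_(x in B) h x = \int[mu]_(x in A `\` B) h x.
Proof.
move=> mA mB BA ih; have mAB : measurable (A `\` B) by exact: measurableD.
have {1}-> : A = B `|` (A `\` B) by rewrite setDUK.
rewrite Rintegral_setU//.
- by rewrite addrAC subrr add0r.
- by rewrite setDUK//; apply: integrableS ih.
- by apply/disj_setPS => t [? []].
Qed.

Lemma measurable_set_le (F G : R * R -> R) :
  measurable_fun setT F -> measurable_fun setT G ->
  measurable [set q | F q <= G q] /\ measurable [set q | F q < G q].
Proof.
move=> mF mG; split.
  rewrite (_ : [set q | _] = (fun q => F q <= G q) @^-1` [set true]).
    by rewrite -[_ @^-1` _]setTI; exact: measurable_fun_ler.
  by apply/seteqP; split.
rewrite (_ : [set q | _] = (fun q => F q < G q) @^-1` [set true]).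
  by rewrite -[_ @^-1` _]setTI; exact: measurable_fun_ltr.
by apply/seteqP; split.
Qed.

Lemma plane_affine_bisector_l p u v q : plane_affine p (bisector u v) u q =
  plane_affine p u v (plane_affine 0 ((enorm (u + v))^-1, (enorm (u + v))^-1)
    (1, 0) q).
Proof.
rewrite !plane_affineE /bisector; case: p u v q => [p1 p2] [u1 u2] [v1 v2] [a b].
rewrite /=; set c := (enorm _)^-1; rewrite /GRing.scale/=.
by congr (_, _); ring.
Qed.

Lemma plane_affine_bisector_r p u v q : plane_affine p (bisector u v) v q =
  plane_affine p u v (plane_affine 0 ((enorm (u + v))^-1, (enorm (u + v))^-1)
    (0, 1) q).
Proof.
rewrite !plane_affineE /bisector; case: p u v q => [p1 p2] [u1 u2] [v1 v2] [a b].
rewrite /=; set c := (enorm _)^-1; rewrite /GRing.scale/=.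
by congr (_, _); ring.
Qed.

Lemma det2_bisector_l u v : det2 (bisector u v) u =
  - ((enorm (u + v))^-1 * det2 u v).
Proof.
rewrite /bisector; case: u v => [u1 u2] [v1 v2]; set c := (enorm _)^-1.
by rewrite /det2 /= /GRing.scale/=; ring.
Qed.

Lemma det2_bisector_r u v : det2 (bisector u v) v =
  (enorm (u + v))^-1 * det2 u v.
Proof.
rewrite /bisector; case: u v => [u1 u2] [v1 v2]; set c := (enorm _)^-1.
by rewrite /det2 /= /GRing.scale/=; ring.
Qed.

(** By Fubini the axial integral is the sum of two integrals over a quadrant of
    coordinates [(t, s)].  With [c = 1 / |u + v|], the point
    [p + t *: bisector u v + s *: u] is [p + (c t + s) u + c t v]: the first
    integral is one over the cone [0 <= b <= a], with Jacobian [c].  Likewise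
    the second one is over the cone [0 <= a <= b], and together the two cones
    fill the quadrant. *)
Lemma vline_axis_quadrant f u v p : det2 u v != 0 -> 0 < enorm (u + v) ->
  leb2.-integrable setT (EFin \o f) ->
  vline_axis f u v p =
  enorm (u + v) * \int[leb2]_(q in quadrant 0) f (plane_affine p u v q).
Proof.
move=> D0 n0 If; have nV0 : (enorm (u + v))^-1 != 0 by rewrite invr_eq0 gt_eqF.
have Dl : det2 (bisector u v) u != 0.
  by rewrite det2_bisector_l oppr_eq0 mulf_neq0.
have Dr : det2 (bisector u v) v != 0 by rewrite det2_bisector_r mulf_neq0.
have mI : measurable (`[0, +oo[%classic : set R) by exact: measurable_itv.
rewrite /vline_axis /ray_integral /Defs.vline RintegralD//; last 2 first.
  exact: (ray_integrable_ray_integral p Dl If).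
  exact: (ray_integrable_ray_integral p Dr If).
have -> := Rintegral_Rintegral_fst (integrable_plane_affine p Dl If) mI mI.
have -> := Rintegral_Rintegral_fst (integrable_plane_affine p Dr If) mI mI.
pose c := (enorm (u + v))^-1.
have c0 : 0 < c by rewrite invr_gt0.
pose g := f \o plane_affine p u v.
have Ig : leb2.-integrable setT (EFin \o g) by exact: integrable_plane_affine.
pose S1 : set (R * R) := [set q | 0 <= q.2] `&` [set q | q.2 <= q.1].
pose S2 : set (R * R) := [set q | 0 <= q.1] `&` [set q | q.1 < q.2].
have mS1 : measurable S1.
  apply: measurableI; [apply: (measurable_set_le _ _).1|
    apply: (measurable_set_le _ _).1] => //; exact: measurable_cst.
have mS2 : measurable S2.
  apply: measurableI; [apply: (measurable_set_le _ _).1|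
    apply: (measurable_set_le _ _).2] => //; exact: measurable_cst.
have -> : \int[leb2]_(q in `[0, +oo[ `*` `[0, +oo[)
    (f \o plane_affine p (bisector u v) u) q = c^-1 * \int[leb2]_(q in S1) g q.
  have dc : det2 (c, c) (1, 0) = - c by rewrite /det2/=; ring.
  have := @Rintegral_plane_affine _ g 0 (c, c) (1, 0) S1.
  rewrite dc normrN gtr0_norm// oppr_eq0 gt_eqF// => /(_ isT Ig mS1) <-.
  have -> : plane_affine 0 (c, c) (1, 0) @^-1` S1 = quadrant 0.
    apply/seteqP; split => -[a b]; rewrite quadrantP /preimage /mkset
      plane_affineE /S1 /= mul0r mul1r !addr0 lerDl pmulr_rge0// => -[? ?];
      by split.
  by apply: eq_Rintegral => q _; rewrite /= plane_affine_bisector_l.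
have IQ : leb2.-integrable (`[0, +oo[ `*` `[0, +oo[)
    (EFin \o (f \o plane_affine p (bisector u v) v)).
  apply: (integrableS measurableT); [exact: (measurable_quadrant 0)|by []|].
  exact: integrable_plane_affine.
have -> : \int[leb2]_(q in `[0, +oo[ `*` `[0, +oo[)
    (f \o plane_affine p (bisector u v) v) q = c^-1 * \int[leb2]_(q in S2) g q.
  (* without the null axis s = 0 the second cone is disjoint from the first *)
  rewrite (@Rintegral_setD_null _ _ leb2 _ (setT `*` [set 0]) _ _ _ _ IQ); first last.
  - by rewrite /= product_measure1E// [X in (_ * X)%E]lebesgue_measure_set1 mule0.
  - exact: measurableX.
  - exact: (measurable_quadrant 0).
  have dc : det2 (c, c) (0, 1) = c by rewrite /det2/=; ring.
  have := @Rintegral_plane_affine _ g 0 (c, c) (0, 1) S2.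
  rewrite dc gtr0_norm// gt_eqF// => /(_ isT Ig mS2) <-.
  have -> : plane_affine 0 (c, c) (0, 1) @^-1` S2 =
      quadrant 0 `\` ([set: R] `*` [set 0]).
    apply/seteqP; split => -[a b]; rewrite /setD /mkset quadrantP /preimage
      /mkset plane_affineE /S2 /= mul0r mul1r !addr0 ltrDl pmulr_rge0//.
      move=> [a0 b0]; split; first by split => //; exact: ltW.
      by move=> [_ b00]; rewrite b00 ltxx in b0.
    move=> [[a0 b0] nb]; split => //.
    by rewrite lt_neqAle b0 andbT eq_sym; apply/eqP => b00; apply: nb.
  by apply: eq_Rintegral => q _; rewrite /= plane_affine_bisector_r.
rewrite -mulrDr invrK; congr (_ * _).
rewrite -Rintegral_setU//.
- congr (Rintegral _ _ _); apply/seteqP; split => -[a b]; rewrite quadrantP/=.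
    by move=> [[/= ? ?]|[/= ? ?]]; split; lra.
  by move=> [a0 b0]; have [ba|ab] := leP b a; [left|right]; split.
- apply: (integrableS measurableT) => //; exact: measurableU.
- apply/disj_setPS => q [[_ /=]]; rewrite leNgt => /negP + [_ /=]; by [].
Qed.

Lemma Rintegral_box_square g x s : 0 < s -> leb2.-integrable setT (EFin \o g) ->
  \int[leb2]_(q in `[x.1 - s, x.1 + s[ `*` `[x.2 - s, x.2 + s[) g q =
  4 * s ^+ 2 * avg g x s.
Proof.
move=> s0 Ig; rewrite /avg mulrA mulfV ?mul1r; last first.
  by rewrite mulf_neq0// expf_neq0// gt_eqF.
set B := _ `*` _.
have mB : measurable B by apply: measurableX; exact: measurable_itv.
have mS := measurable_square x s.
have SB : square x s `<=` B.
  by move=> q [/= q1 q2]; split => /=; rewrite in_itv/=;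
    [move: q1|move: q2]; rewrite /ball/= ltr_distlC => /andP[/ltW -> ->].
have B2 : leb2 B = (4 * s ^+ 2)%:E.
  rewrite /B product_measure1E; [|exact: measurable_itv..].
  rewrite /= !lebesgue_measure_itv/= !lte_fin !ltrD2l !gtrN// -!EFinB -EFinM.
  by congr EFin; ring.
rewrite (@Rintegral_setD_null _ _ leb2 _ (B `\` square x s)); first last.
- by apply: (integrableS measurableT) Ig.
- transitivity (leb2 B - leb2 (square x s))%E.
    by rewrite measureD//= ?(setIidr SB)// [ltLHS]B2 ltry.
  by rewrite B2 leb2_square ?ltW// subee.
- exact: measurableD.
- exact: mB.
by rewrite setDD; congr (Rintegral _ _ _); apply/setIidr.
Qed.

(** Inclusion-exclusion: the difference of two quadrants in the first
    coordinate is a half-open strip, and the difference of two strips in the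
    second coordinate is a half-open square. *)
Lemma quadrant_second_difference g x s : 0 < s ->
  leb2.-integrable setT (EFin \o g) ->
  let G a b := \int[leb2]_(q in quadrant (a, b)) g q in
  G (x.1 + s) (x.2 + s) - G (x.1 - s) (x.2 + s) - G (x.1 + s) (x.2 - s) +
  G (x.1 - s) (x.2 - s) = 4 * s ^+ 2 * avg g x s.
Proof.
move=> s0 Ig G; rewrite -Rintegral_box_square//.
have strip b : G (x.1 - s) b - G (x.1 + s) b =
    \int[leb2]_(q in `[x.1 - s, x.1 + s[ `*` `[b, +oo[) g q.
  rewrite /G Rintegral_setB//; [|exact: measurable_quadrant..|].
    congr (Rintegral _ _ _); apply/seteqP; split => -[a c];
      rewrite /setD /mkset !quadrantP/= !in_itv/= !andbT.
      move=> [[xa bc] n]; split => //; rewrite xa ltNge; apply/negP => xa'.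
      exact: n.
    by move=> [/andP[xa ax] bc]; split => // -[]; rewrite leNgt ax.
  by move=> [a c]; rewrite !quadrantP/= => -[xa ?]; split => //; lra.
transitivity ((G (x.1 - s) (x.2 - s) - G (x.1 + s) (x.2 - s)) -
  (G (x.1 - s) (x.2 + s) - G (x.1 + s) (x.2 + s))); first by ring.
have mS b : measurable (`[x.1 - s, x.1 + s[ `*` `[b, +oo[ : set (R * R)).
  by apply: measurableX; exact: measurable_itv.
rewrite (strip (x.2 - s)) (strip (x.2 + s)).
rewrite Rintegral_setB; [|exact: mS|exact: mS| |exact: Ig]; last first.
  by move=> [a c] []/= + + ; rewrite !in_itv/= !andbT => -> xc; split => //; lra.
congr (Rintegral _ _ _); apply/seteqP; split => -[a c];
  rewrite /setD /= !in_itv/= !andbT.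
  move=> [[xa bc] n]; split => //; rewrite bc ltNge; apply/negP => xa'.
  exact: n.
by move=> [xa /andP[bc cb]]; split => // -[_]; rewrite leNgt cb.
Qed.

Lemma Rintegral_quadrant_shift g x : leb2.-integrable setT (EFin \o g) ->
  \int[leb2]_(q in quadrant 0) g (x + q) = \int[leb2]_(q in quadrant x) g q.
Proof.
move=> Ig; have d1 : det2 (1, 0) (0, 1) = 1 :> R by rewrite /det2/=; ring.
have := @Rintegral_plane_affine _ g x (1, 0) (0, 1) (quadrant x).
rewrite d1 normr1 invr1 mul1r oner_eq0 => /(_ isT Ig (measurable_quadrant _)) <-.
have -> : plane_affine x (1, 0) (0, 1) @^-1` quadrant x = quadrant 0.
  by apply/seteqP; split => -[a b]; rewrite /preimage /mkset !quadrantP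
    plane_affineE/= !mul0r !mul1r addr0 add0r !lerDr.
apply: eq_Rintegral => -[a b] _; rewrite plane_affineE/= !mul0r !mul1r addr0 add0r.
by rewrite [x in LHS]surjective_pairing; congr g; congr (_, _); rewrite addrC.
Qed.

End quadrants.
(** * Trigonometry of the two branch directions *)

Section unit_vectors.
Context {R : realType}.
Implicit Types (u v : R * R) (beta : R).

Lemma det2C u v : det2 v u = - det2 u v.
Proof. by rewrite /det2; ring. Qed.

(** Lagrange identity. *)
Lemma dot_det2_sqr u v : dot u v ^+ 2 + det2 u v ^+ 2 = dot u u * dot v v.
Proof. by rewrite /dot /det2; ring. Qed.

Lemma dot_unit u : enorm u = 1 -> dot u u = 1.
Proof.
move=> u1; have d0 : 0 <= dot u u.
  by rewrite /dot -!expr2 addr_ge0 ?sqr_ge0.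
by rewrite -(sqr_sqrtr d0) -/(enorm u) u1 expr1n.
Qed.

Section angle.
Variables (u v : R * R) (beta : R).
Hypotheses (u1 : enorm u = 1) (v1 : enorm v = 1).
Hypotheses (uv : angle u v = 2 * beta) (range : 0 < 2 * beta < pi).

Lemma dot_cos : dot u v = cos (2 * beta).
Proof.
have := dot_det2_sqr u v; rewrite !dot_unit// mulr1 => d1.
rewrite -uv /angle u1 v1 mulr1 divr1 acosK// in_itv/= -ler_norml.
by rewrite -(@expr_le1 _ 2)// real_normK ?num_real//; have := sqr_ge0 (det2 u v); lra.
Qed.

Lemma cos_half_gt0 : 0 < cos beta.
Proof. by apply: cos_gt0_pihalf; move: range => /andP[? ?]; lra. Qed.

Lemma enorm_add_cos : enorm (u + v) = 2 * cos beta.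
Proof.
rewrite /enorm; have -> : dot (u + v) (u + v) = (2 * cos beta) ^+ 2.
  have -> : dot (u + v) (u + v) = dot u u + dot v v + 2 * dot u v.
    by rewrite /dot /=; ring.
  have c2 : cos (2 * beta) = 2 * cos beta ^+ 2 - 1.
    by rewrite mulr_natl cos_mulr2n; ring.
  by rewrite !dot_unit// dot_cos c2; ring.
by rewrite sqrtr_sqr ger0_norm// mulr_ge0// ltW// cos_half_gt0.
Qed.

Lemma norm_det2_sin : `|det2 u v| = sin beta * enorm (u + v).
Proof.
have s0 : 0 < sin (2 * beta) by exact: sin_gt0_pi.
have -> : sin beta * enorm (u + v) = sin (2 * beta).
  by rewrite enorm_add_cos [in RHS]mulr_natl sin_mulr2n; ring.
apply/eqP; rewrite -(@eqrXn2 _ 2)// ?ltW// real_normK ?num_real//.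
have := dot_det2_sqr u v; rewrite !dot_unit// mulr1 sin2cos2 dot_cos => d1.
by apply/eqP; lra.
Qed.

Lemma det2_neq0 : det2 u v != 0.
Proof.
rewrite -normr_gt0 norm_det2_sin enorm_add_cos.
have := sin_gt0_pi range; rewrite mulr_natl sin_mulr2n; lra.
Qed.

Lemma enorm_add_gt0 : 0 < enorm (u + v).
Proof. by rewrite enorm_add_cos mulr_gt0// cos_half_gt0. Qed.

Lemma det2_bisector_l_neq0 : det2 (bisector u v) u != 0.
Proof.
by rewrite det2_bisector_l oppr_eq0 mulf_neq0 ?invr_eq0 ?det2_neq0// gt_eqF//
  enorm_add_gt0.
Qed.

Lemma det2_bisector_r_neq0 : det2 (bisector u v) v != 0.
Proof.
by rewrite det2_bisector_r mulf_neq0 ?invr_eq0 ?det2_neq0// gt_eqF//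
  enorm_add_gt0.
Qed.

End angle.
End unit_vectors.

(** * The second difference of the quadrant integral *)

Section second_differences.
Context {R : realType}.
Local Notation leb := (leb1 R).
Local Notation leb2 := (leb2 R).
Implicit Types (f g F : R * R -> R) (p u v w x y : R * R).

Lemma plane_affine_add p u v x y :
  plane_affine p u v (x + y) = plane_affine (plane_affine p u v x) u v y.
Proof.
case: p u v x y => [? ?] [? ?] [? ?] [? ?] [? ?]; rewrite !plane_affineE/=.
by congr (_, _); ring.
Qed.

(** The inverse of [plane_affine 0 u v], by Cramer's rule. *)
Definition plane_coord u v : R * R -> R * R :=
  plane_affine 0 (v.2 / det2 u v, - u.2 / det2 u v)
    (- v.1 / det2 u v, u.1 / det2 u v).

Lemma plane_coordK u v : det2 u v != 0 ->
  cancel (plane_coord u v) (plane_affine 0 u v).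
Proof.
rewrite /plane_coord; case: u v => [u1 u2] [v1 v2] D0 [p1 p2].
rewrite !plane_affineE; rewrite /det2 /= in D0 *.
by congr (_, _); field.
Qed.

Lemma ae_plane_coord u v (P : set (R * R)) : det2 u v != 0 ->
  {ae leb2, forall x, P x} -> {ae leb2, forall p, P (plane_coord u v p)}.
Proof.
move=> D0; apply: ae_plane_affine.
have -> : det2 (v.2 / det2 u v, - u.2 / det2 u v)
    (- v.1 / det2 u v, u.1 / det2 u v) = (det2 u v)^-1.
  by move: D0; rewrite /det2/= => D0; field.
by rewrite invr_eq0.
Qed.

Lemma second_difference_coord F u v x t :
  second_difference F u v (plane_affine 0 u v x) t =
  let G a b := F (plane_affine 0 u v (a, b)) in
  (t ^+ 2 * `|det2 u v|)^-1 *
  (G (x.1 + t / 2) (x.2 + t / 2) - G (x.1 - t / 2) (x.2 + t / 2)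
   - G (x.1 + t / 2) (x.2 - t / 2) + G (x.1 - t / 2) (x.2 - t / 2)).
Proof.
rewrite /second_difference /=; congr (_ * _).
have ptE (s s' : R) : plane_affine 0 u v x + s *: u + s' *: v =
    plane_affine 0 u v (x.1 + s, x.2 + s').
  by rewrite [RHS](plane_affine_add 0 u v x (s, s')).
by rewrite -!scaleNr !ptE.
Qed.

(** In the coordinates of the frame [(u, v)] the function [F] is the integral of
    [f] over quadrants, so its second difference is the integral over a square
    of side [`|t|].  It is even in [t]: for negative [t] the four vertices are
    the same ones in another order. *)
Lemma second_difference_average f F u v x t : det2 u v != 0 ->
  leb2.-integrable setT (EFin \o f) ->
  (forall p, F p = `|det2 u v| *
    \int[leb2]_(q in quadrant 0) f (plane_affine p u v q)) ->
  t != 0 ->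
  second_difference F u v (plane_affine 0 u v x) t =
  avg (f \o plane_affine 0 u v) x (`|t| / 2).
Proof.
move=> D0 If FE t0; set g := f \o plane_affine 0 u v.
have Ig : leb2.-integrable setT (EFin \o g) by exact: integrable_plane_affine.
pose G a b := \int[leb2]_(q in quadrant (a, b)) g q.
have FG a b : F (plane_affine 0 u v (a, b)) = `|det2 u v| * G a b.
  rewrite FE /G -(Rintegral_quadrant_shift (a, b) Ig); congr (_ * _).
  by apply: eq_Rintegral => q _; rewrite /g /= plane_affine_add.
rewrite second_difference_coord/= !FG -!mulrBr -mulrDr mulrA.
have -> : (t ^+ 2 * `|det2 u v|)^-1 * `|det2 u v| = (4 * (`|t| / 2) ^+ 2)^-1.
  rewrite invfM mulrVK ?unitfE ?normr_eq0//; congr (_^-1).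
  by rewrite expr_div_n real_normK ?num_real//; field.
have n0 : 4 * (`|t| / 2) ^+ 2 != 0 by rewrite mulf_neq0// expf_neq0// mulf_neq0 ?normr_eq0.
apply: (mulfI n0); rewrite mulVKf//.
rewrite -quadrant_second_difference//; last by rewrite divr_gt0 ?normr_gt0.
rewrite -/(G _ _).
have [t_gt0|t_le0] := ltP 0 t; first by rewrite gtr0_norm.
rewrite ler0_norm// mulNr !opprK /G; ring.
Qed.

Lemma half_norm_cvg : `|t| / 2 @[t --> (0 : R)^'] --> (0 : R)^'+.
Proof.
move=> P [d /= d0 dP]; exists d => //= t /= td t0; apply: dP => /=.
  rewrite sub0r normrN ger0_norm; last by rewrite divr_ge0.
  move: td; rewrite sub0r normrN; have := normr_ge0 t; lra.
by rewrite divr_gt0// normr_gt0.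
Qed.

Lemma second_difference_cvg f F u v : det2 u v != 0 ->
  leb2.-integrable setT (EFin \o f) ->
  (forall p, F p = `|det2 u v| *
    \int[leb2]_(q in quadrant 0) f (plane_affine p u v q)) ->
  {ae leb2, forall p, second_difference F u v p t @[t --> 0^'] --> f p}.
Proof.
move=> D0 If FE.
have := plane_lebesgue_differentiation (integrable_plane_affine 0 D0 If).
move=> /(ae_plane_coord D0); apply: ae_imply => p.
rewrite /average_point /= plane_coordK// => avgp.
have avgt := cvg_comp _ _ half_norm_cvg avgp.
apply: cvg_trans avgt; apply: near_eq_cvg; near=> t.
rewrite -[p in RHS](plane_coordK D0) (second_difference_average _ D0 If FE)//=.
by near: t; exact: nbhs_dnbhs_neq.
Unshelve. all: by end_near. Qed.

End second_differences.

(** * Continuous functions with compact support *)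

Section plane_continuous_functions.
Context {R : realType}.
Local Notation leb := (leb1 R).
Local Notation leb2 := (leb2 R).
Implicit Types (f : R * R -> R) (p u v w x : R * R).

(** The sigma-algebra of the plane is a product of Borel sigma-algebras.  It
    contains the open sets because each of them is the union of the rational
    squares that it contains. *)
Lemma open_measurable_plane (A : set (R * R)) : open A -> measurable A.
Proof.
move=> oA.
pose sq (q : rat * rat * rat) : set (R * R) :=
  square (ratr q.1.1, ratr q.1.2) (ratr q.2).
pose F q := if `[< sq q `<=` A >] then sq q else set0.
have -> : A = \bigcup_q F q.
  apply/seteqP; split => [x Ax|x [q _]]; last first.
    by rewrite /F; case: ifPn => // /asboolP; apply.
  have /nbhs_ballP[e /= e0 xeA] : nbhs x A by exact: open_nbhs_nbhs.
  have [|t] := @rat_in_itvoo R 0 (e / 2); first by rewrite divr_gt0.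
  rewrite in_itv/= => /andP[t0 te].
  have [q xq] := rational_approx x t0.
  exists (q, t) => //; rewrite /F ifT//; apply/asboolP => y yq; apply: xeA.
  have qx : square x (ratr t) (ratr q.1, ratr q.2).
    by move: xq => [x1 x2]; split; exact: ball_sym.
  have te' : ratr t + ratr t <= e by lra.
  by have [] := square_subset qx te' yq.
apply: countable_bigcupT_measurable => // q; rewrite /F; case: ifP => // _.
exact: measurable_square.
Qed.

Lemma continuous_measurable_plane f : continuous f -> measurable_fun setT f.
Proof.
move=> /continuousP cf; apply: (measurability _ (RGenOpens.measurableE R)).
move=> _ [_ [a [b ->] <-]]; rewrite setTI; apply: open_measurable_plane.
exact/cf/interval_open.
Qed.

Lemma compact_support_bounds f : continuous_compact_support f ->
  exists M K : R, forall p,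
    `|f p| <= M /\ (f p != 0 -> `|p.1| <= K /\ `|p.2| <= K).
Proof.
move=> [cf cS].
have [M [_ Mf]] := compact_bounded
  (continuous_compact (continuous_subspaceT cf) cS).
have [K [_ Kp]] := compact_bounded cS.
exists (`|M| + 1), (`|K| + 1) => p.
have M1 : M < `|M| + 1 by rewrite ltr_pwDr// ler_norm.
have K1 : K < `|K| + 1 by rewrite ltr_pwDr// ler_norm.
split.
  have [->|fp] := eqVneq (f p) 0; first by rewrite normr0 addr_ge0.
  by apply: Mf => //; exists p => //; exact: subset_closure.
move=> fp; have := Kp _ K1 p (@subset_closure _ [set p | f p != 0] p fp).
by rewrite /= prod_normE ge_max => /andP[].
Qed.

Lemma integrable_bounded_support (phi : R -> R) (M L : R) :
  measurable_fun setT phi -> (forall t, `|phi t| <= M) ->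
  (forall t, phi t != 0 -> `|t| <= L) -> leb.-integrable setT (EFin \o phi).
Proof.
move=> mphi phiM phiL.
pose I : set R := `[- L, L]%classic.
have Ig : leb.-integrable setT (fun t => (M%:E * (EFin \o \1_I) t)%E).
  by apply: integrableZl => //; exact: integrable_indic_itv.
apply: le_integrable Ig => //; first exact/measurable_EFinP.
move=> t _; rewrite lee_fin /= indicE.
have M0 : 0 <= M by exact: le_trans (normr_ge0 _) (phiM 0).
have [->|phit] := eqVneq (phi t) 0; first by rewrite normr0.
have tL : I t by rewrite /I /= in_itv/= -ler_norml phiL.
by rewrite mem_set// mulr1 (ger0_norm M0).
Qed.

Lemma integrable_compact_support f : continuous_compact_support f ->
  leb2.-integrable setT (EFin \o f).
Proof.
move=> fc; have [M [K MK]] := compact_support_bounds fc.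
have mf := continuous_measurable_plane fc.1.
pose B : set (R * R) := `[- K, K] `*` `[- K, K].
have mB : measurable B by apply: measurableX; exact: measurable_itv.
apply: (@le_integrable _ _ _ leb2 setT measurableT _
  (fun t => (M%:E * (EFin \o \1_B) t)%E)).
- exact/measurable_EFinP.
- move=> t _; rewrite lee_fin /= indicE.
  have M0 : 0 <= M by exact: le_trans (normr_ge0 _) (MK 0).1.
  have [->|phit] := eqVneq (f t) 0; first by rewrite normr0.
  have [ftM /(_ phit)[t1 t2]] := MK t.
  have tB : B t by split; rewrite /= in_itv/= -ler_norml.
  by rewrite mem_set// mulr1 (ger0_norm M0).
- apply: integrableZl => //; apply: integrable_indic_fin => //.
  rewrite product_measure1E; [|exact: measurable_itv..].
  by rewrite /= !lebesgue_measure_itv/= lte_fin; case: ifP; rewrite ?mul0e ?ltry.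
Qed.

Lemma line_continuous p w : continuous (fun t : R => p + t *: w).
Proof.
move=> t; apply: cvgD; first exact: cvg_cst.
exact: scalel_continuous.
Qed.

(** The linear form of coefficients [(a, b)] reads off the parameter [t] of the
    line, and it is bounded on the support. *)
Lemma line_support_bound (a b K t : R) p w : a * w.1 + b * w.2 = 1 ->
  `|(p + t *: w).1| <= K -> `|(p + t *: w).2| <= K ->
  `|t| <= (`|a| + `|b|) * K + `|a * p.1 + b * p.2|.
Proof.
move=> w1 K1 K2.
have -> : t = (a * (p + t *: w).1 + b * (p + t *: w).2) - (a * p.1 + b * p.2).
  have -> : t = t * (a * w.1 + b * w.2) by rewrite w1 mulr1.
  by rewrite w1 mulr1 /= /GRing.scale /=; rewrite -[t in LHS]mulr1 -w1; ring.
rewrite (le_trans (ler_normB _ _))// lerD2r (le_trans (ler_normD _ _))//.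
by rewrite !normrM mulrDl lerD// ler_wpM2l.
Qed.

Lemma ray_integrable_line f p w : continuous_compact_support f ->
  dot w w = 1 -> leb.-integrable setT (fun t => (f (p + t *: w))%:E).
Proof.
move=> fc w1; have [M [K MK]] := compact_support_bounds fc.
apply: (@integrable_bounded_support (fun t => f (p + t *: w)) M
  ((`|w.1| + `|w.2|) * K + `|w.1 * p.1 + w.2 * p.2|)).
- apply: continuous_measurable_fun => t.
  by apply: continuous_comp; [exact: line_continuous|exact: fc.1].
- by move=> t; have [] := MK (p + t *: w).
- move=> t ft; have [_ /(_ ft)[K1 K2]] := MK (p + t *: w).
  exact: line_support_bound w1 K1 K2.
Qed.

(** Dominated convergence.  The linear form of coefficients [(a, b)] below is 1
    on [u] and 0 on [v]: it bounds the parameter of the ray in the support of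
    [f] uniformly in [s], which gives an integrable majorant. *)
Lemma ray_integral_continuous f p u v : continuous_compact_support f ->
  det2 u v != 0 -> continuous (fun s : R => ray_integral f u (p + s *: v)).
Proof.
move=> fc D0 s; have [M [K MK]] := compact_support_bounds fc.
pose a := v.2 / det2 u v; pose b := - v.1 / det2 u v.
have abu : a * u.1 + b * u.2 = 1.
  by rewrite /a /b; move: D0; rewrite /det2 => D0; field.
have abv : a * v.1 + b * v.2 = 0.
  by rewrite /a /b; move: D0; rewrite /det2 => D0; field.
pose L := (`|a| + `|b|) * K + `|a * p.1 + b * p.2|.
have fL l t : f (p + l *: v + t *: u) != 0 -> `|t| <= L.
  move=> ft; have [_ /(_ ft)[K1 K2]] := MK (p + l *: v + t *: u).
  have := line_support_bound abu K1 K2.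
  have -> // : a * (p + l *: v).1 + b * (p + l *: v).2 = a * p.1 + b * p.2.
  rewrite /= /GRing.scale /=.
  have -> : a * (p.1 + l * v.1) + b * (p.2 + l * v.2) =
    a * p.1 + b * p.2 + l * (a * v.1 + b * v.2) by ring.
  by rewrite abv mulr0 addr0.
have cf (l : R) : continuous (fun t : R => f (p + l *: v + t *: u)).
  by move=> t; apply: continuous_comp; [exact: line_continuous|exact: fc.1].
have If l : leb.-integrable `[0, +oo[ (EFin \o (fun t => f (p + l *: v + t *: u))).
  apply: (integrableS measurableT); [exact: measurable_itv|by []|].
  apply: (@integrable_bounded_support _ M L) => //.
  - exact: continuous_measurable_fun.
  - by move=> t; have [] := MK (p + l *: v + t *: u).
  - by move=> t; exact: fL.
apply: (@continuity_under_integral _ _ _ leb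
  (fun l t => f (p + l *: v + t *: u)) `[0, +oo[%classic _ (s - 1) (s + 1) _ _
  (fun t => M * \1_(`[- L, L]) t)).
- exact: measurable_itv.
- by move=> l _; exact: If.
- apply: aeW => t _ l _; apply: continuous_comp; last exact: fc.1.
  by apply: cvgD; [exact: line_continuous|exact: cvg_cst].
- apply: (integrableS measurableT); [exact: measurable_itv|by []|].
  apply: (@integrableZl _ _ _ leb setT measurableT M (EFin \o \1_(`[- L, L]))).
  exact: integrable_indic_itv.
- move=> l _; apply: aeW => t _; rewrite indicE.
  have M0 : 0 <= M by exact: le_trans (normr_ge0 _) (MK 0).1.
  have [->|ft] := eqVneq (f (p + l *: v + t *: u)) 0.
    by rewrite normr0 mulr_ge0.
  rewrite mem_set/= ?mulr1; first by have [] := MK (p + l *: v + t *: u).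
  by rewrite in_itv/= -ler_norml (fL l).
- by rewrite inE/= in_itv/= ltrBlDr ltrDl ltr01.
Qed.

End plane_continuous_functions.

Section ray_derivative.
Context {R : realType}.
Local Notation leb := (leb1 R).
Local Notation leb2 := (leb2 R).
Implicit Types (f phi : R * R -> R) (p u v w x : R * R).

(** This form suits the fundamental theorem of calculus, which concerns a
    variable upper bound. *)
Lemma Rintegral_tail_shift (psi : R -> R) (h : R) :
  leb.-integrable setT (EFin \o psi) ->
  \int[leb]_(t in `[0, +oo[) psi (h + t) =
  \int[leb]_t psi t - \int[leb]_(t in `]-oo, h]) psi t.
Proof.
move=> Ipsi.
have mI : measurable (`[h, +oo[%classic : set R) by exact: measurable_itv.
have Ih : leb.-integrable setT (EFin \o (psi \_ `[h, +oo[)).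
  exact: integrable_restrict.
have -> : \int[leb]_(t in `[0, +oo[) psi (h + t) = \int[leb]_(t in `[h, +oo[) psi t.
  rewrite Rintegral_mkcond [RHS]Rintegral_mkcond /Rintegral.
  transitivity (fine (\int[leb]_t ((EFin \o (psi \_ `[h, +oo[)) (1 * t + h)%R))%E).
    congr fine; apply: eq_integral => t _ /=; rewrite !patchE.
    have -> : (1 * t + h \in `[h, +oo[%classic) = (t \in `[0, +oo[%classic).
      by apply/idP/idP; rewrite !inE/= !in_itv/= !andbT mul1r lerDr.
    by rewrite mul1r addrC.
  rewrite (@integral_scaling_map _ _ R leb (fun t => 1 * t + h) 1 _ _ _ _ Ih).
  - by rewrite mul1e.
  - exact: ler01.
  - exact: measurable_affine.
  - move=> A mA; have := lebesgue_measure_affine h (oner_neq0 R) mA.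
    by rewrite normr1 invr1.
rewrite -Rintegral_itv_obnd_cbnd; last first.
  by apply: (integrableS measurableT) Ipsi => //; exact: measurable_itv.
by have := @Rintegral_itvB R psi -oo%O +oo%O h; rewrite set_itvNyy => ->.
Qed.

Lemma is_derive_tail_integral (psi : R -> R) : continuous psi ->
  leb.-integrable setT (EFin \o psi) ->
  is_derive (0 : R) (1 : R)
    (fun h => \int[leb]_(t in `[0, +oo[) psi (h + t)) (- psi 0).
Proof.
move=> cpsi Ipsi.
rewrite (funext (fun h => Rintegral_tail_shift h Ipsi)).
have Ipsi1 : leb.-integrable [set` Interval -oo%O (BRight (1 : R))] (EFin \o psi).
  by apply: (integrableS measurableT) Ipsi => //; exact: measurable_itv.
have [dF F0] := continuous_FTC1 (@ltr01 R) Ipsi1 (ltNyr 0) (cpsi 0).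
have isF : is_derive (0 : R) (1 : R)
    (fun h => \int[leb]_(t in `]-oo, h]) psi t) (psi 0).
  by apply: DeriveDef; [exact: dF|exact: etrans (esym (derive1E _ _)) F0].
rewrite -[X in is_derive _ _ _ X]sub0r.
by apply: is_deriveB.
Qed.

Lemma is_derive_line f p v (df : R) :
  is_derive (0 : R) (1 : R) (fun h : R => f (h *: v + p)) df ->
  is_derive p v f df.
Proof.
move=> [df0 dfE]; apply: DeriveDef; first exact/derivable1P.
rewrite -dfE /derive; set g1 := fun h => h^-1 *: _; set g2 := fun h => h^-1 *: _.
suff -> : g1 = g2 by [].
by rewrite funeqE /g1 /g2 => h /=; rewrite addr0 scale0r add0r [_%:A]mulr1.
Qed.

(** Moving the vertex along the ray only moves the lower bound of the
    integral. *)
Lemma is_derive_ray_integral phi p v :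
  continuous (fun s : R => phi (p + s *: v)) ->
  leb.-integrable setT (fun s => (phi (p + s *: v))%:E) ->
  is_derive p v (ray_integral phi v) (- phi p).
Proof.
move=> cphi Iphi; apply: is_derive_line.
have := is_derive_tail_integral cphi Iphi; rewrite scale0r addr0.
congr (is_derive _ _ _ _); apply/funext => h; rewrite /ray_integral.
by apply: eq_Rintegral => t _; rewrite scalerDl addrA [h *: v + p]addrC.
Qed.

(** The same plane integral as in [vline_axis_quadrant], read by Fubini with the
    [v] direction outermost.  The roles of [u] and [v] are exchanged first:
    the transform is symmetric in them. *)
Lemma vline_axis_iterated f u v p : det2 u v != 0 -> 0 < enorm (u + v) ->
  leb2.-integrable setT (EFin \o f) ->
  vline_axis f u v p = enorm (u + v) * ray_integral (ray_integral f u) v p.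
Proof.
move=> D0 n0 If.
have D0' : det2 v u != 0.
  by rewrite det2C oppr_eq0.
have bC : bisector u v = bisector v u by rewrite /bisector (addrC v u).
have vC : Defs.vline f u v = Defs.vline f v u.
  by apply/funext => q; exact: addrC.
rewrite /vline_axis bC vC -/(vline_axis f v u p) (addrC u v).
rewrite (addrC u v) in n0; rewrite vline_axis_quadrant//; congr (_ * _).
by rewrite -Rintegral_Rintegral_fst//; exact: integrable_plane_affine.
Qed.

End ray_derivative.
Section continuous_inversion.
Context {R : realType}.
Local Notation leb := (leb1 R).
Local Notation leb2 := (leb2 R).
Variables (f : R * R -> R) (u v : R * R).
Hypotheses (fc : continuous_compact_support f) (D0 : det2 u v != 0).
Hypotheses (n0 : 0 < enorm (u + v)) (u1 : dot u u = 1).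

(** The outer ray integral is differentiated along its own direction [v]. *)
Lemma is_derive_vline_axis p : is_derive p v (vline_axis f u v)
  (- (enorm (u + v) * ray_integral f u p)).
Proof.
have If := integrable_compact_support fc.
have -> : vline_axis f u v = enorm (u + v) \*: ray_integral (ray_integral f u) v.
  by apply/funext => q; exact: vline_axis_iterated.
have D0' : det2 v u != 0.
  by rewrite det2C oppr_eq0.
rewrite -mulrN; apply: is_deriveZ; apply: is_derive_ray_integral.
  exact: ray_integral_continuous.
apply: (integrable_Rintegral_fst (h := f \o plane_affine p v u)) => //.
exact: integrable_plane_affine.
Qed.

(** Each differentiation brings a minus sign, and the two cancel. *)
Lemma is_derive_derive_vline_axis p :
  is_derive p u ('D_v (vline_axis f u v)) (enorm (u + v) * f p).
Proof.
have -> : 'D_v (vline_axis f u v) = - enorm (u + v) \*: ray_integral f u.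
  apply/funext => q; have [_ ->] := is_derive_vline_axis q.
  by rewrite -mulNr.
rewrite -mulrNN; apply: is_deriveZ; apply: is_derive_ray_integral.
  by move=> s; apply: continuous_comp; [exact: line_continuous|exact: fc.1].
exact: ray_integrable_line.
Qed.

End continuous_inversion.


(** * The inversion formulas *)

Theorem corollary2 (R : realType) (u v : R * R) (beta : R)
  (free_uv : free [:: u; v])
  (unit_u : enorm u = 1) (unit_v : enorm v = 1)
  (angle_uv : angle u v = 2 * beta)
  (beta_range : 0 < 2 * beta < pi) :
  (forall f : R * R -> R, continuous_compact_support f ->
    (forall p, vline_defined f u v p /\ vline_axis_defined f u v p) /\
    (forall p, derivable (vline_axis f u v) p v) /\
    (forall p, derivable ('D_v (vline_axis f u v)) p u) /\
    (forall p, f p = (2 * cos beta)^-1 * 'D_u ('D_v (vline_axis f u v)) p))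
  /\
  (forall f : R * R -> R, (leb2 R).-integrable setT (fun p => (f p)%:E) ->
    (forall p, vline_axis_defined f u v p) /\
    (\forall p \ae leb2 R,
      second_difference (fun q => sin beta * vline_axis f u v q) u v p t
        @[t --> 0^'] --> f p)).
Proof.
have D0 := det2_neq0 unit_u unit_v angle_uv beta_range.
have n0 := enorm_add_gt0 unit_u unit_v angle_uv beta_range.
have Dl := det2_bisector_l_neq0 unit_u unit_v angle_uv beta_range.
have Dr := det2_bisector_r_neq0 unit_u unit_v angle_uv beta_range.
have uu := dot_unit unit_u; have vv := dot_unit unit_v.
split=> f => [fc|If].
  have If := integrable_compact_support fc.
  split; [move=> p; split; [|exact: vline_axis_defined_L1]|split; [|split]].
  - by split; apply: (integrableS measurableT); [exact: measurable_itv| |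
      exact: ray_integrable_line|exact: measurable_itv| |exact: ray_integrable_line].
  - by move=> p; have [] := is_derive_vline_axis fc D0 n0 p.
  - by move=> p; have [] := is_derive_derive_vline_axis fc D0 n0 uu p.
  - move=> p; have [_ ->] := is_derive_derive_vline_axis fc D0 n0 uu p.
    rewrite -(enorm_add_cos unit_u unit_v angle_uv beta_range).
    by rewrite mulKf// gt_eqF.
split; first by move=> p; exact: vline_axis_defined_L1.
apply: (second_difference_cvg D0 If) => p.
rewrite (norm_det2_sin unit_u unit_v angle_uv beta_range) -mulrA.
by rewrite -vline_axis_quadrant.
Qed.
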